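(* Assume that $\Omega$ is finitely connected at the boundary. Then all prime ends of $\Omega$ have singleton impressions, and every $x\in\partial\Omega$ is the impression of a prime end (i.e. there is a prime end with impression $\{x\}$) and is accessible. Furthermore, if $1\le p\in Q(x)$ and $Q(x)\neq(0,1]$ for each $x\in\partial\Omega$, then $\partial_P\Omega$ is also the $\mathrm{Mod}_p$-prime end boundary.
   Context: Setting: $(X,d,\mu)$ is a metric measure space with more than one point, $\mu$ is a Borel measure with $0<\mu(B)<\infty$ for all balls $B$, and $1\le p<\infty$ is fixed. $X$ is complete, $\mu$ is doubling (there is $C_\mu>0$ with $\mu(B(x,2r))\le C_\mu\mu(B(x,r))$ for all balls), and $X$ supports a $p$-Poincaré inequality: there are $C_{PI}>0$, $\lambda\ge1$ such that for all balls $B$ and all $u\in N^{1,p}(X)$, $\frac{1}{\mu(B)}\int_B|u-u_B|\,d\mu\le C_{PI}\operatorname{diam}(B)\bigl(\frac{1}{\mu(\lambda B)}\int_{\lambda B}g_u^p\,d\mu\bigr)^{1/p}$, where $u_B=\frac{1}{\mu(B)}\int_B u\,d\mu$. Here a nonnegative Borel function $g$ is an upper gradient of $u:X\to[-\infty,\infty]$ if for every nonconstant rectifiable curve $\gamma:[0,l_\gamma]\to X$ parameterized by arc length, $|u(\gamma(0))-u(\gamma(l_\gamma))|\le\int_\gamma g\,ds$ when both values are finite, and $\int_\gamma g\,ds=\infty$ otherwise; $N^{1,p}(X)$ is the space of measurable $u$ with $\int_X|u|^p\,d\mu+\inf_g\int_X g^p\,d\mu<\infty$ (infimum over upper gradients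 $g$ of $u$), and $g_u$ is the minimal $p$-weak upper gradient of $u$ (the a.e.-smallest $L^p$ function satisfying the upper gradient inequality for all curves except a family $\Gamma$ for which some nonnegative Borel $\rho\in L^p(X)$ has $\int_\gamma\rho\,ds=\infty$ for all $\gamma\in\Gamma$). $\Omega\subsetneq X$ is a bounded domain (bounded nonempty connected open set); closures and boundaries of subsets of $\Omega$ are taken in $X$. Ends: A bounded connected set $E\subsetneq\Omega$ is acceptable if $\overline E\cap\partial\Omega\ne\varnothing$. A sequence $\{E_k\}_{k=1}^\infty$ of acceptable sets is a chain if (i) $E_{k+1}\subset E_k$ for all $k$; (ii) $\operatorname{dist}(\Omega\cap\partial E_{k+1},\Omega\cap\partial E_k)>0$ for all $k$; (iii) the impression $\bigcap_{k=1}^\infty\overline{E}_k$ is contained in $\partial\Omega$. A chain $\{E_k\}$ divides a chain $\{F_k\}$ if for each $k$ there is $l$ with $E_l\subset F_k$. Two chains are equivalent if they divide each other; an end $[E_k]$ is an equivalence class of chains, and its impression $I[E_k]$ is the impression of any representative chain. Division is well defined between ends. A prime end is an end that is not divisible by any other end. The prime end boundary $\partial_P\Omega$ is the set of all prime ends. Accessibility: $x\in\partial\Omega$ is accessible if there is a (possibly nonrectifiable) curve $\gamma:[0,1]\to X$ with $\gamma(1)=x$ and $\gamma([0,1))\subset\Omega$. Finite connectedness: $\Omega$ is finitely connected at $x_0\in\partial\Omega$ if for every $r>0$ there is an open set $G\subset X$ with $x_0\in G\subset B(x_0,r)$ such that $G\cap\Omega$ has only finitely many components. $\Omega$ is finitely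 connected at the boundary if this holds at every $x_0\in\partial\Omega$. Modulus: for a family $\Gamma$ of nonconstant rectifiable curves, $\mathrm{Mod}_p(\Gamma)=\inf_\rho\int_X\rho^p\,d\mu$, the infimum over nonnegative Borel $\rho$ with $\int_\gamma\rho\,ds\ge1$ for all $\gamma\in\Gamma$. $\mathrm{Mod}_p(E,F,U)$ is the $p$-modulus of the family of nonconstant rectifiable curves in $U$ starting in $E$ and ending in $F$. A chain $\{E_k\}$ is a $\mathrm{Mod}_p$-chain if $\lim_{k\to\infty}\mathrm{Mod}_p(E_k,K,\Omega)=0$ for every compact $K\subset\Omega$. An end is a $\mathrm{Mod}_p$-end if some $\mathrm{Mod}_p$-chain represents it. A $\mathrm{Mod}_p$-end is a $\mathrm{Mod}_p$-prime end if the only $\mathrm{Mod}_p$-end dividing it is itself. The $\mathrm{Mod}_p$-prime end boundary is the set of all $\mathrm{Mod}_p$-prime ends. Pointwise dimension set: $Q(x)$ is the set of all $q>0$ for which there are $C_q,R_q>0$ with $\frac{\mu(B(x,r))}{\mu(B(x,R))}\le C_q(r/R)^q$ for all $0<r\le R\le R_q$ (it is a bounded interval with left end point $0$). *)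

(* Defs.v *)
From HB Require Import structures.
From mathcomp Require Import all_boot all_order all_algebra.
From mathcomp Require Import all_classical all_reals all_analysis.
From mathcomp Require Import measurable_realfun.

Set Implicit Arguments.
Unset Strict Implicit.
Unset Printing Implicit Defensive.

Import Order.TTheory GRing.Theory Num.Theory.
Import numFieldNormedType.Exports.

Local Open Scope classical_set_scope.
Local Open Scope ring_scope.

#[short(type="completeMetricType")]
HB.structure Definition CompleteMetric (R : realType) :=
  {T of Metric R T & Complete T}.

Notation borel X := (g_sigma_algebraType (@open X)).
Notation borel_measure X R := {measure set (borel X) -> \bar R}.

Section metric_notions.
Context {R : realType} {X : completeMetricType R}.
Implicit Types (A B : set X) (x : X).

Definition boundary A : set X := closure A `\` interior A.

Definition metric_bounded A : Prop := exists x (r : R), A `<=` ball x r.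

Definition diam A : \bar R :=
  ereal_sup [set (mdist xy.1 xy.2)%:E | xy in A `*` A].

(* The infimum over the empty set is +oo. *)
Definition set_dist A B : \bar R :=
  ereal_inf [set (mdist xy.1 xy.2)%:E | xy in A `*` B].

Definition bounded_domain A : Prop :=
  [/\ open A, A !=set0, connected A & metric_bounded A].

Definition curve_length (f : R -> X) (a b : R) : \bar R :=
  ereal_sup [set (\sum_(0 <= n < size s)
                    mdist (f (nth b (a :: s) n)) (f (nth b (a :: s) n.+1)))%:E
            | s in itv_partition a b].

End metric_notions.

(* A nonconstant rectifiable curve, parameterized by arc length on [0, len];
   the values of par outside [0, len] are irrelevant.  Continuity on [0, len]
   follows from arc_length, since mdist (par s) (par t) <= |t - s|. *)
Record rect_curve (R : realType) (X : completeMetricType R) := RectCurve {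
  len : R ;
  par :> R -> X ;
  len_gt0 : 0 < len ;
  arc_length : forall s t, 0 <= s -> s <= t -> t <= len ->
    curve_length par s t = (t - s)%:E
}.

Section sobolev.
Context {R : realType} {X : completeMetricType R}.
Local Open Scope ereal_scope.
Implicit Types (u v g rho : X -> \bar R) (c : rect_curve X)
  (Gamma : set (rect_curve X)).

Definition line_integral c rho : \bar R :=
  \int[lebesgue_measure]_(t in `[0%R, len c]%classic) rho (c t).

Definition nonneg_borel rho : Prop :=
  measurable_fun [set: borel X] rho /\
  forall x, 0 <= rho x.

Definition upper_gradient_ineq u g c : Prop :=
  if (u (c 0%R) \is a fin_num) && (u (c (len c)) \is a fin_num)
  then is_true (`|u (c 0%R) - u (c (len c))| <= line_integral c g)
  else line_integral c g = +oo.

Definition upper_gradient u g : Prop :=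
  nonneg_borel g /\ forall c, upper_gradient_ineq u g c.

Variables (mu : borel_measure X R) (p : R).

(* Measurability with respect to the completion of mu.  For such functions the
   library integral, a supremum over Borel simple functions below the positive
   and negative parts, agrees with the integral of a Borel representative. *)
Definition mu_measurable u : Prop :=
  exists2 v, measurable_fun [set: borel X] v
           & {ae mu, forall x, u x = v x}.

Definition newtonian u : Prop :=
  mu_measurable u /\
  \int[mu]_x (`|u x| `^ p) +
    ereal_inf [set \int[mu]_x (g x `^ p) | g in upper_gradient u] < +oo.

Definition exceptional Gamma : Prop :=
  exists rho, [/\ nonneg_borel rho, \int[mu]_x (rho x `^ p) < +oo
                & forall c, Gamma c -> line_integral c rho = +oo].

Definition weak_upper_gradient u g : Prop :=
  nonneg_borel g /\ exceptional [set c | ~ upper_gradient_ineq u g c].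

Definition minimal_weak_upper_gradient u g : Prop :=
  [/\ weak_upper_gradient u g, \int[mu]_x (g x `^ p) < +oo
    & forall h, weak_upper_gradient u h -> \int[mu]_x (h x `^ p) < +oo ->
        {ae mu, forall x, g x <= h x}].

Definition average (A : set X) u : \bar R :=
  (fine (mu A))^-1%:E * \int[mu]_(x in A) u x.

Definition finite_positive_on_balls : Prop :=
  forall (x : X) (r : R), (0 < r)%R -> 0 < mu (ball x r) < +oo.

Definition doubling : Prop :=
  exists2 C : R, (0 < C)%R & forall (x : X) (r : R), (0 < r)%R ->
    mu (ball x (2 * r)) <= C%:E * mu (ball x r).

(* Minimal p-weak upper gradients are unique up to mu-null sets, so quantifying
   over all of them is the same as naming g_u. *)
Definition poincare : Prop :=
  exists C lambda : R, [/\ (0 < C)%R, (1 <= lambda)%R &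
    forall (x : X) (r : R) u g, (0 < r)%R ->
      newtonian u -> minimal_weak_upper_gradient u g ->
      average (ball x r) (fun y => `|u y - average (ball x r) u|) <=
      C%:E * diam (ball x r) *
        (average (ball x (lambda * r)) (fun y => g y `^ p)) `^ p^-1].

Definition modulus Gamma : \bar R :=
  ereal_inf [set \int[mu]_x (rho x `^ p) | rho in
    [set rho | nonneg_borel rho /\
               forall c, Gamma c -> 1 <= line_integral c rho]].

Definition connecting_curves (E F U : set X) : set (rect_curve X) :=
  [set c | [/\ forall t : R, (0 <= t <= len c)%R -> U (c t),
               E (c 0%R) & F (c (len c))]].

Definition dimension_set (x : X) : set R :=
  [set q | (0 < q)%R /\
    exists C R0 : R, [/\ (0 < C)%R, (0 < R0)%R &
      forall r s : R, (0 < r)%R -> (r <= s)%R -> (s <= R0)%R ->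
        (fine (mu (ball x r)) / fine (mu (ball x s)) <= C * (r / s) `^ q)%R]].

End sobolev.

Section ends.
Context {R : realType} {X : completeMetricType R}.
Variable Omega : set X.
Implicit Types (A : set X) (E F : nat -> set X) (e f : set (nat -> set X)).

Definition acceptable A : Prop :=
  [/\ A `<` Omega, metric_bounded A, connected A
    & closure A `&` boundary Omega !=set0].

Definition chain_impression E : set X := \bigcap_k closure (E k).

Definition is_chain E : Prop :=
  [/\ forall k, acceptable (E k),
      forall k, E k.+1 `<=` E k,
      forall k, (0 < set_dist (Omega `&` boundary (E k.+1))
                              (Omega `&` boundary (E k)))%E
    & chain_impression E `<=` boundary Omega].

Definition divides E F : Prop := forall k, exists l, E l `<=` F k.

Definition chain_equiv E F : Prop := divides E F /\ divides F E.

Definition end_of E : set (nat -> set X) :=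
  [set F | is_chain F /\ chain_equiv E F].

Definition is_end e : Prop := exists2 E, is_chain E & e = end_of E.

(* Equivalent chains have the same impression; see impression_end below. *)
Definition impression e : set X := \bigcup_(E in e) chain_impression E.

(* Independent of the representatives; see end_dividesP below. *)
Definition end_divides e f : Prop :=
  exists E F, [/\ e E, f F & divides E F].

Definition is_prime_end e : Prop :=
  is_end e /\ forall f, is_end f -> end_divides f e -> f = e.

Definition prime_end_boundary : set (set (nat -> set X)) :=
  [set e | is_prime_end e].

Variables (mu : borel_measure X R) (p : R).

Definition is_Mod_chain E : Prop :=
  is_chain E /\
  forall K, compact K -> K `<=` Omega ->
    modulus mu p (connecting_curves (E k) K Omega) @[k --> \oo] --> 0%E.

Definition is_Mod_end e : Prop :=
  is_end e /\ exists2 E, e E & is_Mod_chain E.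

Definition is_Mod_prime_end e : Prop :=
  is_Mod_end e /\ forall f, is_Mod_end f -> end_divides f e -> f = e.

Definition Mod_prime_end_boundary : set (set (nat -> set X)) :=
  [set e | is_Mod_prime_end e].

Definition accessible (x : X) : Prop :=
  exists c : R -> X, [/\ {within `[0, 1]%classic, continuous c}, c 1 = x
    & forall t, 0 <= t < 1 -> Omega (c t)].

Definition finitely_connected_at (x : X) : Prop :=
  forall r : R, 0 < r -> exists G : set X,
    [/\ open G, G x, G `<=` ball x r
      & finite_set [set connected_component (G `&` Omega) y
                   | y in G `&` Omega]].

Definition finitely_connected_at_boundary : Prop :=
  forall x, boundary Omega x -> finitely_connected_at x.

Lemma divides_trans E F G : divides E F -> divides F G -> divides E G.
Proof.
move=> EF FG k; have [l FGk] := FG k; have [m EFl] := EF l.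
by exists m; apply: subset_trans EFl FGk.
Qed.

Lemma divides_impression E F :
  divides E F -> chain_impression E `<=` chain_impression F.
Proof.
move=> EF x Ex k _; have [l El] := EF k.
exact: (closureS El (Ex l I)).
Qed.

Lemma impression_end e E :
  is_end e -> e E -> impression e = chain_impression E.
Proof.
move=> [E0 _ ->] eE; have [_ [E0E _]] := eE; apply/seteqP; split=> x.
  move=> [F [_ [_ FE0]] Fx].
  exact: (divides_impression E0E (divides_impression FE0 Fx)).
by move=> Ex; exists E.
Qed.

Lemma end_dividesP e f E F : is_end e -> is_end f -> e E -> f F ->
  end_divides e f <-> divides E F.
Proof.
move=> [E0 _ ->] [F0 _ ->] eE fF.
have [_ [_ EE0]] := eE; have [_ [F0F _]] := fF; split.
  move=> [E1 [F1 [[_ [E01 _]] [_ [_ F10]] d]]].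
  apply: divides_trans EE0 _; apply: divides_trans E01 _.
  by apply: divides_trans d _; apply: divides_trans F10 _.
by move=> d; exists E, F; split.
Qed.

End ends.

(* Main.v *)
(** Doubling and completeness make X proper.  For a truncated length function
of eps-chains, 1 is an upper gradient; the Poincare inequality, applied to its
minimal weak upper gradient, makes this function Lipschitz with a constant
independent of eps, and letting eps tend to 0 gives that X is quasiconvex.
Hence components of open sets are open and arcwise connected.

By finite connectedness and pigeonhole, for any decreasing sequence of sets
accumulating at a boundary point x there are nested components F_n of
B(x, r_n) /\ Omega, r_n -> 0, each meeting all sets of the sequence.  Such
(F_n) is a prime end with impression {x}; for the sets of a chain with x in its
impression, (F_n) divides this chain.  Joining points of successive F_n by curves
gives accessibility.

When p lies in Q(x), which is not (0, 1], the family of curves from a small ball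
at x to a fixed distance has small modulus (sum a test function over dyadic
annuli), so (F_n) is a Mod_p-chain.  Since every end is divided by such a prime
end, the prime ends and the Mod_p-prime ends coincide. *)

Require Import Defs.
From mathcomp Require Import all_boot all_order all_algebra.
From mathcomp Require Import all_classical all_reals all_analysis.
From mathcomp Require Import measurable_realfun.
From mathcomp Require Import ring lra.

Set Implicit Arguments.
Unset Strict Implicit.
Unset Printing Implicit Defensive.

Import Order.TTheory GRing.Theory Num.Theory.
Import numFieldNormedType.Exports.

Local Open Scope classical_set_scope.
Local Open Scope ring_scope.

(** * Integrals over subintervals *)

(** The Poincare inequality speaks of minimal [p]-weak upper gradients, so one must exist before the
    inequality says anything about a test function. For [p = 1] there is no reflexivity to extract
    weak limits from; the minimizer is built from pointwise minima of competitors, which is why the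
    minimum of two weak upper gradients is studied along a single curve. Chains replace curves in
    the test function because nothing is known about curves at the outset: the function is
    1-Lipschitz at scale [eps], hence Borel. Truncation puts it into the Newtonian space. The
    indicator of a ball is an upper gradient whatever [eps] is, so [eps] affects only the number of
    halvings in the Lipschitz estimate, not its constant. Finite connectedness concerns some
    neighbourhood [G], not balls. The pigeonhole acts on components of [G] and is transferred to
    balls, where the boundary of a component inside [Omega] lies on a sphere; this gives the
    positive distances required of a chain. Excluding (0, 1] yields an exponent [q > 1] with
    [p <= q]; for [p = q] the modulus over [n] annuli decays only like [n^(1-p)]. *)

Section curve_min.
Context {R : realType}.
Local Open Scope ereal_scope.
Local Notation mu := (@lebesgue_measure R).

Lemma ge0_integral_itv_split (g : R -> \bar R) (s u t : R) :
  measurable_fun setT g -> (forall x, 0 <= g x) -> (s <= u <= t)%R ->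
  \int[mu]_(x in `]s, t]) g x =
  \int[mu]_(x in `]s, u]) g x + \int[mu]_(x in `]u, t]) g x.
Proof.
move=> mg g0 /andP[su ut].
have -> : `]s, t]%classic = `]s, u] `|` `]u, t].
  by rewrite -itv_bndbnd_setU// !bnd_simp.
rewrite ge0_integral_setU//=.
- exact: measurable_funTS.
- apply/disj_setPS => x /=; rewrite !in_itv/= => -[/andP[_ xu] /andP[ux _]].
  by move: ux; rewrite ltNge xu.
Qed.

(** Absolute continuity of the integral; an integrable function is finite almost everywhere, so the
    real-valued [f] may replace it. *)
Lemma ge0_integral_small (g : R -> \bar R) (D : set R) (e : R) :
  measurable D -> measurable_fun setT g -> (forall x, 0 <= g x) ->
  \int[mu]_(x in D) g x < +oo -> (0 < e)%R ->
  exists2 d : R, (0 < d)%R & forall A, measurable A -> A `<=` D ->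
    mu A < d%:E -> \int[mu]_(x in A) g x < e%:E.
Proof.
move=> mD mg g0 gD e0.
pose f x := fine ((g \_ D) x).
have mf : measurable_fun setT f.
  apply: measurableT_comp => //; apply/(measurable_restrictT _ mD).
  exact: measurable_funTS.
have f0 x : (0 <= f x)%R by rewrite /f fine_ge0// patchE; case: ifP.
have ig : mu.-integrable D g.
  apply/integrableP; split; first exact: measurable_funTS.
  by under eq_integral do rewrite gee0_abs//.
have fg A : measurable A -> A `<=` D ->
    \int[mu]_(x in A) (f x)%:E = \int[mu]_(x in A) g x.
  move=> mA AD; apply: ge0_ae_eq_integral => //.
  - by apply: measurable_funTS; exact: measurableT_comp.
  - exact: measurable_funTS.
  - by move=> x _; rewrite lee_fin.
  - have := @integrable_ae _ _ _ mu D mD _ ig; apply: filterS => x /= xfin Ax.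
    rewrite /f patchE mem_set; last exact: AD.
    by rewrite fineK//; apply: xfin; exact: AD.
have fE x : (f x)%:E = ((EFin \o f) \_ D) x.
  by rewrite patchE/= /f patchE; case: ifP.
have intf : mu.-integrable setT (EFin \o f).
  apply/integrableP; split; first exact: measurableT_comp.
  under eq_integral => x _ do rewrite /= ger0_norm// fE.
  by rewrite -integral_mkcond fg.
have [d [d0 dA]] := integral_normr_continuous intf e0.
exists d => // A mA AD Ad; rewrite -fg//.
have := dA _ mA Ad; rewrite /Rintegral.
under eq_integral => x _ do rewrite /= ger0_norm//.
rewrite -lte_fin fineK// fg// ge0_fin_numE ?integral_ge0//.
apply: le_lt_trans gD; apply: ge0_subset_integral => //.
exact: measurable_funTS.
Qed.

(** A finite union of intervals, coded by end points; half-open, so that integrals over []s, t]]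
    split without overlap. *)
Let inU (s : seq (R * R)) (x : R) := has (fun i => (i.1 < x <= i.2)%R) s.

Let measurable_inU s : measurable [set x | inU s x].
Proof.
elim: s => [|[c d] s ih]; first by rewrite (_ : mkset _ = set0)// -subset0.
rewrite (_ : mkset _ = `]c, d] `|` [set x | inU s x]).
  exact: measurableU.
apply/seteqP; split => x /=; rewrite /inU/= in_itv/=.
  by move=> /orP[]; [left|right].
by move=> [->//|h]; apply/orP; right.
Qed.


Let measurable_mix (V : seq (R * R)) (g1 g2 : R -> \bar R) :
  measurable_fun setT g1 -> measurable_fun setT g2 ->
  measurable_fun setT (fun x => if inU V x then g1 x else g2 x).
Proof.
move=> mg1 mg2; apply: measurable_fun_ifT => //.
apply: (measurable_fun_bool true); rewrite setTI.
exact: measurable_inU.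
Qed.

Let le_eq_integral (D : set R) (f g : R -> \bar R) :
  (forall x, D x -> f x = g x) ->
  \int[mu]_(x in D) f x <= \int[mu]_(x in D) g x.
Proof.
move=> fg; rewrite le_eqVlt; apply/orP; left; apply/eqP.
by apply: eq_integral => x /set_mem/fg.
Qed.

(** Induction on the list: an added interval cuts []s, t]] into three pieces. The middle one is
    controlled by [g1], the outer ones by the induction hypothesis. *)
Let curve_mix (F : R -> R) (g1 g2 : R -> \bar R) (a b : R) (V : seq (R * R)) :
  measurable_fun setT g1 -> measurable_fun setT g2 ->
  (forall x, 0 <= g1 x) -> (forall x, 0 <= g2 x) ->
  (forall s t, (a <= s)%R -> (s <= t)%R -> (t <= b)%R ->
    `|F t - F s|%:E <= \int[mu]_(x in `]s, t]) g1 x) ->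
  (forall s t, (a <= s)%R -> (s <= t)%R -> (t <= b)%R ->
    `|F t - F s|%:E <= \int[mu]_(x in `]s, t]) g2 x) ->
  forall s t, (a <= s)%R -> (s <= t)%R -> (t <= b)%R ->
    `|F t - F s|%:E <= \int[mu]_(x in `]s, t])
      (if inU V x then g1 x else g2 x).
Proof.
move=> mg1 mg2 g10 g20 F1 F2; elim: V => [|[c d] V ih] s t as_ st tb.
  exact: F2.
(* The end points are moved into [[s, t]] and put in order, so that an interval that is empty or
   lies outside only produces degenerate pieces. *)
pose c' := Num.max s (Num.min c t); pose d' := Num.max c' (Num.min d t).
have sc' : (s <= c')%R by rewrite le_max lexx.
have c't : (c' <= t)%R by rewrite ge_max st ge_min lexx orbT.
have c'd' : (c' <= d')%R by rewrite le_max lexx.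
have d't : (d' <= t)%R by rewrite ge_max c't ge_min lexx orbT.
have k0 W x : 0 <= (if inU W x then g1 x else g2 x) by case: ifP.
rewrite (ge0_integral_itv_split (u := c')) ?sc'//; last exact: measurable_mix.
rewrite (ge0_integral_itv_split (s := c') (u := d')) ?c'd'//; last exact: measurable_mix.
have -> : (F t - F s = (F c' - F s) + ((F d' - F c') + (F t - F d')))%R by ring.
apply: (le_trans (y := (`|F c' - F s|%:E + (`|F d' - F c'|%:E + `|F t - F d'|%:E)))).
  rewrite -!EFinD lee_fin (le_trans (ler_normD _ _))// lerD2l.
  exact: ler_normD.
apply: leeD; last apply: leeD.
- apply: le_trans (ih _ _ as_ sc' (le_trans c't tb)) _.
  apply: le_eq_integral => x /=; rewrite in_itv/= => /andP[sx]; rewrite le_max leNgt sx/=.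
  by rewrite le_min => /andP[xc _]; rewrite ltNge xc.
- apply: le_trans (F1 _ _ (le_trans as_ sc') c'd' (le_trans d't tb)) _.
  apply: le_eq_integral => x /=; rewrite in_itv/= => /andP[c'x xd'].
  move: xd'; rewrite le_max leNgt c'x/= le_min => /andP[xd xt].
  move: c'x; rewrite gt_max => /andP[sx]; rewrite gt_min [(t < x)%R]ltNge xt orbF.
  by move=> cx; rewrite cx xd.
- apply: le_trans (ih _ _ (le_trans as_ (le_trans sc' c'd')) d't tb) _.
  apply: le_eq_integral => x /=; rewrite in_itv/= => /andP[d'x xt].
  move: d'x; rewrite gt_max => /andP[_]; rewrite gt_min [(t < x)%R]ltNge xt orbF.
  by move=> dx; rewrite (leNgt x) dx andbF.
Qed.

(** One wants [g1] on the set [T] where [g1 < g2] and [g2] elsewhere, but the bounds live on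
    intervals. So [T] is approximated by a finite union [V] of intervals, and absolute continuity
    makes the integrals over the wrongly assigned points small. *)
Lemma curve_min (F : R -> R) (g1 g2 : R -> \bar R) (a b : R) :
  measurable_fun setT g1 -> measurable_fun setT g2 ->
  (forall x, 0 <= g1 x) -> (forall x, 0 <= g2 x) ->
  \int[mu]_(x in `]a, b]) g1 x < +oo ->
  \int[mu]_(x in `]a, b]) g2 x < +oo ->
  (forall s t, (a <= s)%R -> (s <= t)%R -> (t <= b)%R ->
    `|F t - F s|%:E <= \int[mu]_(x in `]s, t]) g1 x) ->
  (forall s t, (a <= s)%R -> (s <= t)%R -> (t <= b)%R ->
    `|F t - F s|%:E <= \int[mu]_(x in `]s, t]) g2 x) ->
  (a <= b)%R ->
  `|F b - F a|%:E <= \int[mu]_(x in `]a, b]) Order.min (g1 x) (g2 x).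
Proof.
move=> mg1 mg2 g10 g20 fg1 fg2 F1 F2 ab; apply/lee_addgt0Pr => e e0.
pose D : set R := `]a, b]%classic; pose m x := Order.min (g1 x) (g2 x).
have mD : measurable D by exact: measurable_itv.
have mm : measurable_fun setT m by exact: measurable_mine.
pose T := D `&` [set x | g1 x < g2 x].
have mT : measurable T by apply: emeasurable_fun_lt => //; exact: measurable_funTS.
have muD : mu D < +oo.
  by rewrite /D lebesgue_measure_itv/=; case: ifP => // _; rewrite -EFinB ltry.
have TD : T `<=` D by exact: subIsetl.
have muT : mu T < +oo by rewrite (le_lt_trans _ muD)// le_measure ?inE.
have e20 : (0 < e / 2)%R by rewrite divr_gt0.
have [d1 d10 D1] := ge0_integral_small mD mg1 g10 fg1 e20.
have [d2 d20 D2] := ge0_integral_small mD mg2 g20 fg2 e20.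
have [U [oU TU UT]] := lebesgue_regularity_outer mT muT d10.
have [K [cK KT TK]] := lebesgue_regularity_inner mT muT d20.
have [V KV VU] : exists2 V : seq (R * R), K `<=` [set x | inU V x] &
    [set x | inU V x] `<=` U.
  (* The open intervals have to cover [K], while their half-open versions have to stay in [U]; hence
     this index set. *)
  have := cK; rewrite compact_cover => /(_ (R * R)%type
    [set i | `]i.1, i.2]%classic `<=` U] (fun i => `]i.1, i.2[%classic)).
  case.
  - by move=> i _; exact: interval_open.
  - move=> x /KT/TU Ux; have := oU; rewrite openE => /(_ _ Ux).
    rewrite /interior nbhs_ballP => -[r /= r0 rU].
    exists (x - r / 2, x + r / 2)%R => /=.
      move=> y /=; rewrite in_itv/= => /andP[h1 h2]; apply: rU; rewrite /ball/=.
      by rewrite ltr_norml; apply/andP; split; lra.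
    by rewrite in_itv/=; apply/andP; split; lra.
  - move=> V VD KV; exists (finmap.enum_fset V).
      move=> x /KV[i/= iV xi]; apply/hasP; exists i => //.
      by move: xi; rewrite in_itv/= => /andP[-> /ltW].
    by move=> x /= /hasP[i /VD]; rewrite inE => iU xi; apply: iU; rewrite /= in_itv.
have mV := measurable_inU V.
have mU : measurable U by exact: open_measurable.
apply: le_trans (curve_mix V mg1 mg2 g10 g20 F1 F2 (lexx a) ab (lexx b)) _.
(* [A1] and [A2] are the points where the mixture takes the wrong function: [A1] lies in [U] minus
   [T], [A2] in [T] minus [K]. *)
pose A1 := D `&` ([set x | inU V x] `\` T).
pose A2 := D `&` (T `\` [set x | inU V x]).
have mA1 : measurable A1 by apply: measurableI => //; exact: measurableD.
have mA2 : measurable A2 by apply: measurableI => //; exact: measurableD.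
have I1 : \int[mu]_(x in A1) g1 x < (e / 2)%:E.
  apply: D1 => //; first exact: subIsetl.
  rewrite (le_lt_trans _ UT)// le_measure ?inE//; first exact: measurableD.
  by move=> x [_ [xV nT]]; split => //; exact: VU.
have I2 : \int[mu]_(x in A2) g2 x < (e / 2)%:E.
  apply: D2 => //; first exact: subIsetl.
  rewrite (le_lt_trans _ TK)// le_measure ?inE//.
    by apply: measurableD => //; apply: compact_measurable.
  by move=> x [_ [xT nV]]; split => // /KV.
apply: (le_trans (y := \int[mu]_(x in D) (m x + ((g1 \_ A1) x + (g2 \_ A2) x)))).
  have mr1 : measurable_fun setT (g1 \_ A1).
    by apply/(measurable_restrictT _ mA1); exact: measurable_funTS.
  have mr2 : measurable_fun setT (g2 \_ A2).
    by apply/(measurable_restrictT _ mA2); exact: measurable_funTS.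
  apply: ge0_le_integral => //.
  - by move=> x _; case: ifP.
  - by apply: measurable_funTS; exact: measurable_mix.
  - by apply: measurable_funTS; do 2 apply: emeasurable_funD => //.
  move=> x Dx; rewrite !patchE.
  have [xT|xT] := pselect (T x).
    have -> : m x = g1 x by rewrite /m min_l// ltW//; case: xT.
    rewrite (memNset (A := A1)); last by move=> [_ []].
    case: ifPn => xV; first by rewrite leeDl// add0e; case: ifP.
    rewrite mem_set; last by split => //; split=> //; apply/negP.
    by rewrite add0e leeDr.
  have -> : m x = g2 x.
    by rewrite /m min_r// leNgt; apply/negP => h; apply: xT; split.
  case: ifPn => xV; last by rewrite leeDl// adde_ge0//; case: ifP.
  rewrite (mem_set (A := A1)); last by split.
  rewrite addeCA leeDl// adde_ge0//; case: ifP => //.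
have m0 x : 0 <= m x by rewrite /m le_min g10 g20.
have mr1 : measurable_fun D (g1 \_ A1).
  by apply: measurable_funTS; apply/(measurable_restrictT _ mA1); exact: measurable_funTS.
have mr2 : measurable_fun D (g2 \_ A2).
  by apply: measurable_funTS; apply/(measurable_restrictT _ mA2); exact: measurable_funTS.
rewrite ge0_integralD//=; last 3 first.
- exact: measurable_funTS.
- by move=> x _; rewrite adde_ge0// patchE; case: ifP.
- exact: emeasurable_funD.
rewrite ge0_integralD//=; last 2 first.
- by move=> x _; rewrite patchE; case: ifP.
- by move=> x _; rewrite patchE; case: ifP.
rewrite -!integral_mkcondr (setIidr (@subIsetl _ D _)) (setIidr (@subIsetl _ D _)).
rewrite leeD2l// [e in leRHS]splitr EFinD.
by rewrite leeD// ltW.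
Qed.
End curve_min.
(** * Curves *)

Section curves.
Context {R : realType} {X : completeMetricType R}.
Local Notation mu := (@lebesgue_measure R).
Implicit Types (c : rect_curve X) (rho : X -> \bar R).

Lemma ballE (x : X) (r : R) y : ball x r y = (mdist x y < r).
Proof. by rewrite ballEmdist. Qed.

Lemma dist_curve_le c s t : 0 <= s -> s <= t -> t <= len c ->
  mdist (c s) (c t) <= t - s.
Proof.
move=> s0 st tl; have := arc_length s0 st tl.
move: st; rewrite le_eqVlt => /predU1P[->|st]; first by rewrite mdistxx subrr.
move=> h; rewrite -lee_fin -h; apply: ereal_sup_ubound.
exists [:: t]; first exact: itv_partition1.
by rewrite /= big_nat1.
Qed.

(** The values of a curve outside [[0, len c]] are arbitrary; this constant extension is 1-Lipschitz
    on the whole line, so composing a Borel function with it is measurable on all of [R]. *)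
Definition clamp_curve c (t : R) : X := c (Num.max 0 (Num.min (len c) t)).

Lemma clamp_curveE c t : 0 <= t <= len c -> clamp_curve c t = c t.
Proof. by move=> /andP[t0 tl]; rewrite /clamp_curve min_r// max_r. Qed.

Lemma dist_clamp_curve_le c s t :
  mdist (clamp_curve c s) (clamp_curve c t) <= `|t - s|.
Proof.
wlog st : s t / s <= t => [H|].
  by have [/H//|/ltW/H] := leP s t; rewrite metric_sym distrC.
have l0 := len_gt0 c; rewrite (ger0_norm (x := t - s)) ?subr_ge0//.
pose g t := Num.max 0 (Num.min (len c) t).
have gst : g s <= g t by rewrite /g le_max2//= le_min2.
apply: (@le_trans _ _ (g t - g s)).
  apply: dist_curve_le => //; rewrite /g ?le_max ?lexx//.
  by rewrite ge_max ltW//= ge_min lexx.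
rewrite /g; case: (ltP 0 (Num.min (len c) t)); case: (ltP 0 (Num.min (len c) s));
 rewrite /Num.min; do 2 case: ifPn; rewrite -?leNgt; lra.
Qed.

Lemma continuous_clamp_curve c : continuous (clamp_curve c).
Proof.
move=> t; apply/(@metricType_numDomainType.cvgrPdist_lt _ X) => e e0.
near=> s; apply: le_lt_trans (dist_clamp_curve_le _ _ _) _.
rewrite distrC; near: s; exact: (@cvgr_dist_lt _ _ _ (nbhs t)).
Unshelve. all: by end_near. Qed.

Lemma measurable_clamp_curve c rho :
  measurable_fun [set: borel X] rho ->
  measurable_fun [set: R] (rho \o clamp_curve c).
Proof.
move=> mrho; apply: (@measurableT_comp _ _ _ _ (borel X)) => //.
apply: (@measurability _ _ R (borel X) setT (clamp_curve c) (@open X) erefl).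
move=> _ [U oU <-]; rewrite setTI; apply: open_measurable.
by move/continuousP : (@continuous_clamp_curve c); exact.
Qed.

Lemma line_integral_clamp c rho :
  line_integral c rho = (\int[mu]_(t in `[0%R, len c]) rho (clamp_curve c t))%E.
Proof.
by apply: eq_integral => t; rewrite inE/= in_itv/= => h; rewrite clamp_curveE.
Qed.

Lemma line_integral_clamp_oc c rho :
  measurable_fun [set: borel X] rho ->
  line_integral c rho = (\int[mu]_(t in `]0%R, len c]) rho (clamp_curve c t))%E.
Proof.
move=> mrho; rewrite line_integral_clamp integral_itv_obnd_cbnd//.
by apply: measurable_funTS; exact: measurable_clamp_curve.
Qed.

Let curve_length_shift_le (f : R -> X) s a b :
  (curve_length (fun x => f (s + x)%R) a b <= curve_length f (s + a)%R (s + b)%R)%E.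
Proof.
apply: ub_ereal_sup => _ [l [pl /eqP lb] <-].
apply: ereal_sup_ubound; exists (map (fun x => s + x) l).
  split; last by rewrite last_map lb.
  by rewrite path_map; apply: sub_path pl => x y /= xy; rewrite ltrD2l.
congr EFin; rewrite size_map; apply: eq_big_nat => i /= il.
have nE k : (k < (size l).+1)%N ->
    nth (s + b) (s + a :: [seq s + x | x <- l]) k = s + nth b (a :: l) k.
  by move=> kl; rewrite -(nth_map _ (s + b) (+%R s) (s := a :: l)).
by have /= -> := nE i.+1 il; rewrite nE// ltnW.
Qed.

Lemma curve_length_shift (f : R -> X) s a b :
  curve_length (fun x => f (s + x)) a b = curve_length f (s + a) (s + b).
Proof.
apply/eqP; rewrite eq_le curve_length_shift_le/=.
have := curve_length_shift_le (fun x => f (s + x)) (- s) (s + a) (s + b).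
by rewrite !addKr; under [X in (curve_length X _ _ <= _)%E -> _]eq_fun do rewrite addNKr.
Qed.

Section subcurve.
Variables (c : rect_curve X) (s t : R).
Hypotheses (s0 : 0 <= s) (st : s < t) (tl : t <= len c).

Let subcurve_gt0 : 0 < t - s. Proof. by rewrite subr_gt0. Qed.

Let subcurve_arc u v : 0 <= u -> u <= v -> v <= t - s ->
  curve_length (fun x => c (s + x)) u v = (v - u)%:E.
Proof.
move=> u0 uv vts; rewrite curve_length_shift arc_length; last 3 first.
- exact: addr_ge0.
- by rewrite lerD2l.
- by rewrite (le_trans _ tl)// -lerBrDl.
by congr EFin; ring.
Qed.

Definition subcurve := RectCurve subcurve_gt0 subcurve_arc.

Lemma line_integral_subcurve rho :
  measurable_fun [set: borel X] rho -> (forall x, 0 <= rho x)%E ->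
  line_integral subcurve rho =
  (\int[mu]_(x in `]s, t]) rho (clamp_curve c x))%E.
Proof.
move=> mrho rho0.
have mh := measurable_clamp_curve c mrho.
pose sh (x : measurableTypeR R) : measurableTypeR R := s + x.
have mshift : measurable_fun [set: measurableTypeR R] sh.
  by apply: measurable_funD.
rewrite integral_itv_obnd_cbnd; last exact: measurable_funTS.
(* Translation invariance of Lebesgue measure, from uniqueness of the measure with these values on
   half-open intervals. *)
have shiftE A : measurable A -> pushforward mu sh A = mu A.
  move=> mA; apply/esym/(@lebesgue_measure_unique _ (pushforward mu sh)) =>
    //= _ [[a b]] _ <-.
  rewrite /pushforward (_ : _ @^-1` _ = `]a - s, b - s]%classic); last first.
    by apply/seteqP; split => x /=; rewrite !in_itv/= /sh ltrBlDl lerBrDl.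
  rewrite !lebesgue_measure_itv/= !lte_fin ltrD2r; case: ifP => // _.
  by rewrite -!EFinB; congr EFin; ring.
transitivity (\int[mu]_(x in sh @^-1` `[s, t]) (rho \o clamp_curve c) (sh x))%E.
  rewrite (_ : _ @^-1` _ = `[0, t - s]%classic); last first.
    by apply/seteqP; split => x /=; rewrite !in_itv/= /sh lerDl lerBrDl.
  apply: eq_integral => x; rewrite inE/= in_itv/= => /andP[x0 xts].
  by rewrite clamp_curveE// addr_ge0//= (le_trans _ tl)// -lerBrDl.
rewrite -(@ge0_integral_pushforward _ _ _ _ _ _ mshift mu `[s, t]
  (rho \o clamp_curve c))//.
- by apply: eq_measure_integral => A mA _; apply: shiftE.
- exact: measurable_funTS.
- by move=> y _; exact: rho0.
Qed.

End subcurve.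
End curves.
(** * Minimal weak upper gradients *)

Section weak_upper_gradients.
Context {R : realType} {X : completeMetricType R}.
Variables (mu : borel_measure X R) (p : R).
Hypothesis p1 : 1 <= p.
Local Open Scope ereal_scope.
Implicit Types (c : rect_curve X) (rho g h : X -> \bar R).
Local Notation leb := (@lebesgue_measure R).

Let p_gt0 : (0 < p)%R. Proof. exact: lt_le_trans p1. Qed.

Let p_neq0 : p != 0%R. Proof. by rewrite gt_eqF. Qed.

Lemma poweRK (x : \bar R) : 0 <= x -> (x `^ p) `^ p^-1 = x.
Proof. by move=> x0; rewrite -poweRrM mulfV// poweRe1. Qed.

Lemma poweRVK (x : \bar R) : 0 <= x -> (x `^ p^-1) `^ p = x.
Proof. by move=> x0; rewrite -poweRrM mulVf// poweRe1. Qed.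

Lemma le_poweR (q : R) (x y : \bar R) : (0 <= q)%R -> 0 <= x -> x <= y ->
  x `^ q <= y `^ q.
Proof.
move=> q0 x0 xy; apply: gt0_ler_poweR => //; rewrite in_itv/= leey andbT//.
exact: le_trans xy.
Qed.

Lemma measurable_fun_poweR d (T : measurableType d) (D : set T) (g : T -> \bar R)
  (q : R) :
  measurable_fun D g -> measurable_fun D (fun x => g x `^ q).
Proof. by move=> mg; apply: (measurableT_comp (measurable_poweR q)). Qed.

(** The [p]-th root of a weighted sum of [p]-th powers dominates a positive multiple of each
    witness; adding powers rather than functions avoids the triangle inequality for the [p]-norm. *)
Lemma exceptional_bigcup (Gamma : nat -> set (rect_curve X)) :
  (forall n, exceptional mu p (Gamma n)) -> exceptional mu p (\bigcup_n Gamma n).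
Proof.
move=> eG; pose rho n := projT1 (cid (eG n)).
have rhoP n : [/\ nonneg_borel (rho n), \int[mu]_x (rho n x `^ p) < +oo
   & forall c, Gamma n c -> line_integral c (rho n) = +oo].
  exact: (projT2 (cid (eG n))).
have r0 n x : 0 <= rho n x by have [[_ +] _ _] := rhoP n; exact.
have mr n : measurable_fun [set: borel X] (rho n) by have [[+ _] _ _] := rhoP n; exact.
have mrp n : measurable_fun [set: borel X] (fun x => rho n x `^ p).
  exact: measurable_fun_poweR.
pose I n := fine (\int[mu]_x (rho n x `^ p)).
have I0 n : (0 <= I n)%R by apply: fine_ge0; apply: integral_ge0 => x _; exact: poweR_ge0.
have IE n : \int[mu]_x (rho n x `^ p) = (I n)%:E.
  rewrite fineK// ge0_fin_numE; first by have [] := rhoP n.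
  by apply: integral_ge0 => x _; exact: poweR_ge0.
(* With this weight the [n]-th term has integral at most [2^-(n+1)]; the summand 1 keeps the
   quotient meaningful when [I n] vanishes. *)
pose a n : R := (1 / (2 ^ n.+1)%:R / (1 + I n))%R.
have a0 n : (0 < a n)%R.
  by rewrite divr_gt0 ?divr_gt0 ?ltr_pwDl// ltr0n expn_gt0.
pose f n x := (a n)%:E * rho n x `^ p.
have f0 n x : 0 <= f n x by rewrite mule_ge0 ?poweR_ge0// lee_fin ltW.
have mf n : measurable_fun [set: borel X] (f n).
  by apply: emeasurable_funM => //; exact: measurable_cst.
pose s x := \sum_(0 <= n <oo) f n x.
have s0 x : 0 <= s x by apply: nneseries_ge0.
have ms : measurable_fun [set: borel X] s.
  exact: ge0_emeasurable_sum.
exists (fun x => s x `^ p^-1); split.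
- by split => [|x]; [exact: measurable_fun_poweR|exact: poweR_ge0].
- under eq_integral do rewrite poweRVK//.
  rewrite /s integral_nneseries//.
  apply: (@le_lt_trans _ _ (\sum_(0 <= n <oo) (1 / (2 ^ n.+1)%:R)%:E)).
    apply: lee_nneseries => [n _ _|n _].
      by apply: integral_ge0.
    rewrite ge0_integralZl// ?lee_fin ?(ltW (a0 n))//; last by move=> x _;
      exact: poweR_ge0.
    rewrite IE -EFinM lee_fin /a mulrAC ler_pdivrMr ?ltr_pwDl//.
    by rewrite ler_wpM2l ?divr_ge0// lerDr.
  exact: le_lt_trans (@epsilon_trick0 R 1 xpredT ler01) (ltry _).
- move=> c [n _ Gc].
  have [_ _ /(_ c Gc) li] := rhoP n.
  apply/eqP; rewrite -leye_eq.
  apply: (@le_trans _ _ ((a n `^ p^-1)%:E * line_integral c (rho n))).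
    by rewrite li gt0_muley// lte_fin powR_gt0.
  rewrite !line_integral_clamp -ge0_integralZl//=; last 2 first.
  - by apply: measurable_funTS; exact: measurable_clamp_curve.
  - by rewrite lee_fin powR_ge0.
  apply: ge0_le_integral => //.
  - by move=> x _; rewrite mule_ge0// lee_fin powR_ge0.
  - apply: measurable_funTS; apply: emeasurable_funM; first exact: measurable_cst.
    exact: measurable_clamp_curve.
  - apply: measurable_funTS;
    apply: (measurable_clamp_curve c (rho := fun x => s x `^ p^-1)).
    exact: measurable_fun_poweR.
  move=> x _; rewrite -poweR_EFin -{1}[rho n _]poweRK// -poweRM ?lee_fin ?(ltW (a0 n))
    ?poweR_ge0//.
  apply: le_poweR; [by rewrite invr_ge0 ltW|exact: f0|].
  rewrite /s (nneseriesD1 (n := n))// leeDl//.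
  exact: nneseries_ge0.
Qed.

Lemma exceptional_infinite_integral g : nonneg_borel g ->
  \int[mu]_x (g x `^ p) < +oo ->
  exceptional mu p [set c | line_integral c g = +oo].
Proof. by move=> ng ig; exists g. Qed.

Lemma exceptional_sub (G H : set (rect_curve X)) :
  G `<=` H -> exceptional mu p H -> exceptional mu p G.
Proof. by move=> GH [rho [n i l]]; exists rho; split => // c /GH/l. Qed.

Variable v : X -> R.
Let u x := (v x)%:E.

Lemma upper_gradient_ineqE g c : upper_gradient_ineq u g c <->
  `|v (c 0%R) - v (c (len c))|%:E <= line_integral c g.
Proof. by []. Qed.

(* Off an exceptional family every subcurve satisfies the upper gradient
   inequality, since the line integral of an exceptional function over a
   subcurve is at most that over the curve. *)
Lemma weak_upper_gradient_subcurve g : weak_upper_gradient mu p u g ->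
  exceptional mu p [set c | ~ forall s t : R, (0 <= s)%R -> (s <= t)%R ->
    (t <= len c)%R -> `|v (clamp_curve c t) - v (clamp_curve c s)|%:E <=
       \int[leb]_(x in `]s, t]) g (clamp_curve c x)].
Proof.
move=> [[mg g0] [rho [[mrho rho0] irho lrho]]].
exists rho; split => // c cP; apply: contrapT => /eqP; rewrite -ltey => crho.
apply: cP => s t s0; rewrite le_eqVlt => /predU1P[<- _|st tl].
  by rewrite subrr normr0 integral_ge0.
have := @lrho (subcurve s0 st tl).
rewrite /= upper_gradient_ineqE !line_integral_subcurve//= addr0 subrKC.
rewrite -(clamp_curveE (t := s)) ?s0 ?(le_trans (ltW st) tl)//.
rewrite -(clamp_curveE (t := t)) ?tl ?(le_trans s0 (ltW st))//.
rewrite distrC => h; apply: contrapT => /h ioo.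
suff : \int[leb]_(x in `]s, t]) rho (clamp_curve c x) < +oo by rewrite ioo.
apply: le_lt_trans crho; rewrite line_integral_clamp_oc//.
apply: ge0_subset_integral => //.
  by apply: measurable_funTS; exact: measurable_clamp_curve.
by move=> x /=; rewrite !in_itv/= => /andP[sx xt];
  rewrite (le_lt_trans s0)//= (le_trans xt).
Qed.

(** Off four exceptional families both line integrals are finite and both functions control every
    subcurve, which is what [curve_min] asks of [v] along the curve. *)
Lemma weak_upper_gradient_min g h :
  weak_upper_gradient mu p u g -> \int[mu]_x (g x `^ p) < +oo ->
  weak_upper_gradient mu p u h -> \int[mu]_x (h x `^ p) < +oo ->
  weak_upper_gradient mu p u (fun x => Order.min (g x) (h x)).
Proof.
move=> wg ig wh ih.
have [[mg g0] _] := wg; have [[mh h0] _] := wh.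
split.
  by split => [|x]; [exact: measurable_mine|rewrite le_min g0 h0].
pose G (n : nat) := match n with
  | 0 => [set c | line_integral c g = +oo]
  | 1 => [set c | line_integral c h = +oo]
  | 2 => [set c | ~ forall s t : R, (0 <= s)%R -> (s <= t)%R ->
    (t <= len c)%R -> `|v (clamp_curve c t) - v (clamp_curve c s)|%:E <=
       \int[leb]_(x in `]s, t]) g (clamp_curve c x)]
  | _ => [set c | ~ forall s t : R, (0 <= s)%R -> (s <= t)%R ->
    (t <= len c)%R -> `|v (clamp_curve c t) - v (clamp_curve c s)|%:E <=
       \int[leb]_(x in `]s, t]) h (clamp_curve c x)] end.
apply: (@exceptional_sub _ (\bigcup_n G n)); last first.
  apply: exceptional_bigcup => -[|[|[|n]]].
  - exact: exceptional_infinite_integral.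
  - exact: exceptional_infinite_integral.
  - exact: weak_upper_gradient_subcurve.
  - exact: weak_upper_gradient_subcurve.
move=> c cP; apply: contrapT => nG; apply: cP.
have {}nG n : ~ G n c by move=> Gc; apply: nG; exists n.
have cg : line_integral c g < +oo.
  by rewrite ltey; apply/eqP => e; apply: (nG 0%N).
have ch : line_integral c h < +oo.
  by rewrite ltey; apply/eqP => e; apply: (nG 1%N).
apply/upper_gradient_ineqE.
have l0 := ltW (len_gt0 c).
rewrite -(clamp_curveE (t := 0%R)) ?lexx// -(clamp_curveE (t := len c)) ?lexx ?l0//.
rewrite distrC line_integral_clamp_oc; last exact: measurable_mine.
rewrite !line_integral_clamp_oc// in cg ch.
apply: (@curve_min _ (v \o clamp_curve c) (g \o clamp_curve c) (h \o clamp_curve c)) =>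
  //=.
- exact: measurable_clamp_curve.
- exact: measurable_clamp_curve.
- by apply: contrapT => nc; apply: (nG 2%N).
- by apply: contrapT => nc; apply: (nG 3%N).
Qed.

(** Along a curve with finite line integral of [g 0] dominated convergence carries the inequality to
    the limit; the other curves form an exceptional family. *)
Lemma weak_upper_gradient_inf (g : nat -> X -> \bar R) :
  (forall n, weak_upper_gradient mu p u (g n)) ->
  \int[mu]_x (g 0%N x `^ p) < +oo ->
  (forall n x, g n.+1 x <= g n x) ->
  weak_upper_gradient mu p u (fun x => ereal_inf (range (g ^~ x))).
Proof.
move=> wg ig gS.
have g0 n x : 0 <= g n x by have [[_ +] _] := wg n.
have mg n : measurable_fun [set: borel X] (g n) by have [[+ _] _] := wg n.
have dg x : {homo g^~ x : n m / (n <= m)%N >-> m <= n}.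
  by apply/nonincreasing_seqP => n; exact: gS.
pose h x := ereal_inf (range (g ^~ x)).
have gh x : g^~ x @ \oo --> h x by exact: ereal_nonincreasing_cvgn.
have h0 x : 0 <= h x by apply: le_ereal_inf_tmp => _ [n _ <-].
have mh : measurable_fun [set: borel X] h.
  by apply: (@emeasurable_fun_cvg _ (borel X) R setT g h) => // x _; exact: gh.
split; first by [].
pose G (n : nat) := if n is n.+1 then [set c | ~ upper_gradient_ineq u (g n) c]
  else [set c | line_integral c (g 0%N) = +oo].
apply: (@exceptional_sub _ (\bigcup_n G n)); last first.
  apply: exceptional_bigcup => -[|n].
    exact: exceptional_infinite_integral.
  by have [_] := wg n.
move=> c cP; apply: contrapT => nG; apply: cP.
have {}nG n : ~ G n c by move=> Gc; apply: nG; exists n.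
apply/upper_gradient_ineqE.
have cn n : `|v (c 0%R) - v (c (len c))|%:E <= line_integral c (g n).
  by apply/upper_gradient_ineqE; apply: contrapT => nc; apply: (nG n.+1).
have c0 : line_integral c (g 0%N) < +oo.
  by rewrite ltey; apply/eqP => e; apply: (nG 0%N).
have : line_integral c (g n) @[n --> \oo] --> line_integral c h.
  rewrite line_integral_clamp; under eq_fun do rewrite line_integral_clamp.
  have mD : measurable (`[0%R, len c]%classic : set R) by exact: measurable_itv.
  have mgc n : measurable_fun `[0%R, len c] (g n \o clamp_curve c).
    by apply: measurable_funTS; exact: measurable_clamp_curve.
  have mhc : measurable_fun `[0%R, len c] (h \o clamp_curve c).
    by apply: measurable_funTS; exact: measurable_clamp_curve.
  have := @dominated_convergence _ _ _ leb _ mD (fun n => g n \o clamp_curve c)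
    (h \o clamp_curve c) (g 0%N \o clamp_curve c) mgc mhc.
  case=> //.
  - by apply: aeW => x _; exact: gh.
  - apply/integrableP; split; first exact: mgc.
    by rewrite line_integral_clamp in c0; under eq_integral do rewrite /= gee0_abs ?g0//.
  - by apply: aeW => x n _; rewrite gee0_abs//=; exact: dg.
move=> hcvg; rewrite -(cvg_lim _ hcvg)//; apply: lime_ge; last exact: nearW.
by apply/cvg_ex; eexists; exact: hcvg.
Qed.

(* Pointwise minima of a minimizing sequence decrease to a minimizer of the
   energy, and the minimum of this minimizer with any competitor has no smaller
   energy, so it agrees with the minimizer almost everywhere. *)
Lemma minimal_weak_upper_gradient_exists k :
  weak_upper_gradient mu p u k -> \int[mu]_x (k x `^ p) < +oo ->
  exists g, minimal_weak_upper_gradient mu p u g.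
Proof.
move=> wk ik.
pose W : set (X -> \bar R) :=
  [set h | weak_upper_gradient mu p u h /\ \int[mu]_x (h x `^ p) < +oo].
pose E h := \int[mu]_x (h x `^ p).
have E0 h : 0 <= E h by apply: integral_ge0 => x _; exact: poweR_ge0.
have mE h : W h -> measurable_fun [set: borel X] (fun x => h x `^ p).
  by move=> [[[mh _] _] _]; exact: measurable_fun_poweR.
have W0 h x : W h -> 0 <= h x by move=> [[[_ +] _] _]; exact.
have leE h h' : W h -> W h' -> (forall x, h x <= h' x) -> E h <= E h'.
  move=> Wh Wh' hh'; apply: ge0_le_integral => //.
  - by move=> x _; exact: poweR_ge0.
  - exact: mE.
  - exact: mE.
  - by move=> x _; apply: le_poweR => //; [exact: ltW|exact: W0].
have Wmin h h' : W h -> W h' -> W (fun x => Order.min (h x) (h' x)).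
  move=> Wh Wh'; have [w1 i1] := Wh; have [w2 i2] := Wh'.
  have wm := weak_upper_gradient_min w1 i1 w2 i2; split => //.
  apply: le_lt_trans i1; apply: ge0_le_integral => //.
  - by move=> x _; exact: poweR_ge0.
  - by case: wm => [[mm _] _]; exact: measurable_fun_poweR.
  - exact: mE.
  - move=> x _; apply: le_poweR; [exact: ltW|by rewrite le_min !W0|].
    by rewrite ge_min lexx.
pose m := ereal_inf (E @` W).
have m0 : 0 <= m by apply: le_ereal_inf_tmp => _ [h _ <-]; exact: E0.
have mfin : m \is a fin_num.
  rewrite ge0_fin_numE//; apply: le_lt_trans (ik); apply: ereal_inf_lbound.
  by exists k.
have /choice[h hP] : forall n, exists h, W h /\ E h < m + (n.+1%:R^-1)%:E.
  move=> n; have : m < m + (n.+1%:R^-1)%:E.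
    by rewrite lte_spaddre// lte_fin invr_gt0.
  by move=> /ereal_inf_lt[_ [h Wh <-] hm]; exists h.
pose g := fix g n := if n is n'.+1 then (fun x => Order.min (g n' x) (h n x)) else h 0%N.
have Wg n : W (g n).
  elim: n => [|n ih]; first by have [] := hP 0%N.
  by apply: Wmin => //; have [] := hP n.+1.
have gS n x : g n.+1 x <= g n x by rewrite /= ge_min lexx.
have gh n x : g n x <= h n x by case: n => [|n] //=; rewrite ge_min lexx orbT.
pose f x := ereal_inf (range (g ^~ x)).
have wf : weak_upper_gradient mu p u f.
  by apply: weak_upper_gradient_inf => // [n|]; [case: (Wg n)|case: (Wg 0%N)].
have fg n x : f x <= g n x by apply: ereal_inf_lbound; exists n.
have f0 x : 0 <= f x by case: wf => -[_ +] _; exact.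
have mf : measurable_fun [set: borel X] f by case: wf => -[+ _] _.
have Efg n : E f <= E (g n).
  apply: ge0_le_integral => //.
  - by move=> x _; exact: poweR_ge0.
  - exact: measurable_fun_poweR.
  - exact: mE.
  - by move=> x _; apply: le_poweR => //; exact: ltW.
have Wf : W f by split => //; apply: le_lt_trans (Efg 0%N) _; case: (Wg 0%N).
have Efm : E f <= m.
  apply/lee_addgt0Pr => e e0; have [n ne] := ltr_add_invr e0.
  have [Wh hm] := hP n.
  rewrite (le_trans (Efg n))// (le_trans (leE _ _ (Wg n) Wh (gh n)))//.
  by rewrite (le_trans (ltW hm))// leeD2l// lee_fin; move: ne; rewrite add0r => /ltW.
exists f; split => //; first by case: Wf.
move=> q wq iq; have Wq : W q by [].
pose r x := Order.min (f x) (q x).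
have Wr : W r by exact: Wmin.
have rf x : r x <= f x by rewrite /r ge_min lexx.
have ir A : measurable A -> \int[mu]_(x in A) (r x `^ p) <= \int[mu]_(x in A) (f x `^ p).
  move=> mA; apply: ge0_le_integral => //.
  - by move=> x _; exact: poweR_ge0.
  - by apply: measurable_funTS; exact: mE.
  - by apply: measurable_funTS; exact: mE.
  - by move=> x _; apply: le_poweR => //; [exact: ltW|exact: W0].
have ifin A : measurable A -> \int[mu]_(x in A) (f x `^ p) < +oo.
  move=> mA; have [_ +] := Wf; apply: le_lt_trans.
  apply: ge0_subset_integral => //; first exact: mE.
  by move=> x _; exact: poweR_ge0.
have spl (s : X -> \bar R) A : measurable (A : set (borel X)) -> W s ->
    E s = \int[mu]_(x in A) (s x `^ p) + \int[mu]_(x in ~` A) (s x `^ p).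
  move=> mA Ws; rewrite /E -{1}(setUv A) ge0_integral_setU//.
  - exact: measurableC.
  - by rewrite setUv; exact: mE.
  - by move=> x _; exact: poweR_ge0.
  - by apply/disj_setPS => x [].
have : ae_eq mu setT (fun x => f x `^ p) (fun x => r x `^ p).
  apply: integral_ae_eq => //.
  - apply/integrableP; split; first exact: mE.
    under eq_integral do rewrite gee0_abs ?poweR_ge0//.
    by case: Wf.
  - exact: mE.
  (* The [p]-th power of [r] has no larger integral than that of [f] on [A] and on its complement,
     while [E f <= m <= E r]. All values being finite, both inequalities are equalities. *)
  move=> A _ mA; apply/eqP; rewrite eq_le ir// andbT.
  have rm : E f <= E r.
    by apply: le_trans Efm _; apply: ereal_inf_lbound; exists r.
  have mAC := measurableC mA.
  have fA := ifin _ mA; have fAC := ifin _ mAC.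
  have := ir _ mA; have := ir _ mAC; move: rm.
  rewrite (spl f A)// (spl r A)//.
  move: fA fAC.
  have : 0 <= \int[mu]_(x in A) (f x `^ p) by apply: integral_ge0 => x _;
    exact: poweR_ge0.
  have : 0 <= \int[mu]_(x in A) (r x `^ p) by apply: integral_ge0 => x _;
    exact: poweR_ge0.
  have : 0 <= \int[mu]_(x in ~` A) (f x `^ p) by apply: integral_ge0 => x _;
    exact: poweR_ge0.
  have : 0 <= \int[mu]_(x in ~` A) (r x `^ p) by apply: integral_ge0 => x _;
    exact: poweR_ge0.
  case: (\int[mu]_(x in A) (f x `^ p)) => //= a1;
    case: (\int[mu]_(x in A) (r x `^ p)) => //= a2;
  case: (\int[mu]_(x in ~` A) (f x `^ p)) => //= a3;
    case: (\int[mu]_(x in ~` A) (r x `^ p)) => //= a4.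
  rewrite -!EFinD !lee_fin => *; lra.
apply: filterS => x /(_ I) /= e.
have : r x = f x.
  by rewrite -(poweRK (x := r x)) ?W0// -(poweRK (x := f x)) ?W0// e.
by move=> <-; rewrite /r ge_min lexx orbT.
Qed.

End weak_upper_gradients.
(** * Properness *)

Section properness.
Context {R : realType} {X : completeMetricType R}.
Variable mu : borel_measure X R.
Hypothesis mu_balls : finite_positive_on_balls mu.
Hypothesis mu_doubling : doubling mu.

Lemma open_ball (x : X) (r : R) : open (ball x r).
Proof.
rewrite openE => y; rewrite ballE => xy; apply/nbhs_ballP.
exists (r - mdist x y) => /=; first by rewrite subr_gt0.
by move=> z; rewrite !ballE => yz;
  rewrite (le_lt_trans (metric_triangle x y z))// -ltrBrDl.
Qed.

Lemma borel_open (A : set X) : open A -> measurable (A : set (borel X)).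
Proof. exact: sub_gen_smallest. Qed.

Lemma borel_ball (x : X) (r : R) : measurable (ball x r : set (borel X)).
Proof. by apply: borel_open; exact: open_ball. Qed.

Lemma ball_measure_fin (x : X) (r : R) : 0 < r ->
  mu (ball x r) = (fine (mu (ball x r)))%:E.
Proof.
move=> r0; have /andP[_ h] := mu_balls x r0.
by rewrite fineK// ge0_fin_numE.
Qed.

Lemma ball_measure_gt0 (x : X) (r : R) : 0 < r -> 0 < fine (mu (ball x r)).
Proof. by move=> r0; rewrite fine_gt0//; exact: mu_balls. Qed.

Lemma doublingR : exists2 C : R, 0 < C &
  forall (x : X) (r : R), 0 < r -> fine (mu (ball x (2 * r))) <= C * fine (mu (ball x r)).
Proof.
have [C C0 HC] := mu_doubling; exists C => // x r r0.
have r20 : 0 < 2 * r by rewrite mulr_gt0.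
by have := HC x r r0;
  rewrite (ball_measure_fin x r0) (ball_measure_fin x r20) -EFinM lee_fin.
Qed.

Lemma ball_measure_le (x y : X) (r s : R) : 0 < s -> ball x r `<=` ball y s ->
  fine (mu (ball x r)) <= fine (mu (ball y s)).
Proof.
move=> s0 xy; rewrite fine_le//.
- rewrite ge0_fin_numE//; apply: (@le_lt_trans _ _ (mu (ball y s))).
    by apply: le_measure; rewrite ?inE//; exact: borel_ball.
  by rewrite ball_measure_fin// ltry.
- by rewrite ball_measure_fin.
- by apply: le_measure; rewrite ?inE//; exact: borel_ball.
Qed.

Lemma doubling_iter : exists2 C : R, 0 < C &
  forall (x : X) (r : R) n, 0 < r ->
    fine (mu (ball x (2 ^+ n * r))) <= C ^+ n * fine (mu (ball x r)).
Proof.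
have [C C0 HC] := doublingR; exists C => // x r n r0.
elim: n => [|n ih]; first by rewrite !expr0 !mul1r.
rewrite !exprS -!mulrA (le_trans (HC _ _ _)) ?mulr_gt0 ?exprn_gt0//.
by rewrite ler_pM2l.
Qed.

Let separated (e : R) (s : seq X) := pairwise (fun y z => e <= mdist y z) s.

(** Balls of radius [e / 2] around [e]-separated points are disjoint, so removing the first from [D]
    leaves the others inside. *)
Let measure_separated (e m : R) (s : seq X) (D : set X) :
  0 < e -> measurable (D : set (borel X)) ->
    (forall y, y \in s -> ball y (e / 2) `<=` D) ->
  (forall y, y \in s -> m <= fine (mu (ball y (e / 2)))) ->
  separated e s -> (((size s)%:R * m)%:E <= mu D)%E.
Proof.
move=> e0; elim: s D => [|y s ih] D mD sD ms; first by rewrite mul0r.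
rewrite /separated /= => /andP[/allP ys ss].
have e20 : 0 < e / 2 by rewrite divr_gt0.
have yD : ball y (e / 2) `<=` D by apply: sD; rewrite mem_head.
rewrite -(setDUK yD) measureU//; last 3 first.
- exact: borel_ball.
- by apply: measurableD => //; exact: borel_ball.
- by rewrite setDE setICA setICr setI0.
rewrite -natr1 mulrDl mul1r addrC EFinD leeD//.
  by rewrite -[leRHS]/(mu (ball y (e / 2))) ball_measure_fin// lee_fin; apply: ms;
    rewrite mem_head.
apply: ih => //.
- by apply: measurableD => //; exact: borel_ball.
- move=> z zs w zw; split; first by apply: (sD z) => //; rewrite inE zs orbT.
  move: zw; rewrite !ballE => zw yw.
  have := ys _ zs; have := metric_triangle y w z; rewrite (metric_sym w z).
  by move: zw yw; set a := mdist z w; set b := mdist y w; set c := mdist y z => *; lra.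
- by move=> z zs; apply: ms; rewrite inE zs orbT.
Qed.

(** Without a finite cover there are arbitrarily many [e]-separated points in the ball. Doubling
    bounds the measures of the half-radius balls around them from below, so too many exceed the
    measure of [ball x (r + e)]. *)
Lemma ball_totally_bounded (x : X) (r e : R) : 0 < r -> 0 < e ->
  exists s : seq X, ball x r `<=` \bigcup_(y in [set` s]) ball y e.
Proof.
move=> r0 e0; apply: contrapT => nos.
have [C C0 HC] := doubling_iter.
have e20 : 0 < e / 2 by rewrite divr_gt0.
have sep n : exists s : seq X,
  [/\ size s = n, separated e s & {in s, forall y, ball x r y}].
  elim: n => [|n [s [sn ss sx]]]; first by exists [::].
  have : ~ (ball x r `<=` \bigcup_(y in [set` s]) ball y e).
    by move=> h; apply: nos; exists s.
  move=> /existsNP[y /not_implyP[xy ny]].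
  exists (y :: s); split; first by rewrite /= sn.
    rewrite /separated/= -/(separated e s) ss andbT; apply/allP => z zs.
    rewrite leNgt; apply/negP => h; apply: ny; exists z => //.
    by rewrite ballE metric_sym.
  by move=> z; rewrite inE => /predU1P[->|/sx].
(* After [k] doublings each ball of radius [e / 2] centred in [ball x r] contains [ball x (r + e)],
   the centres being less than [r] apart. *)
have [k kP] : exists k, r + (r + e) < 2 ^+ k * (e / 2).
  pose q := (r + (r + e)) / (e / 2).
  have q0 : 0 <= q by rewrite divr_ge0 ?addr_ge0 ?ltW.
  exists (Num.truncn q).+1; rewrite -ltr_pdivrMr// -/q.
  apply: (lt_trans (truncnS_gt q)).
  by rewrite -natrX ltr_nat ltn_expl.
pose M := fine (mu (ball x (r + e))).
have re0 : 0 < r + e by rewrite addr_gt0.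
have M0 : 0 < M by exact: ball_measure_gt0.
pose m := M / C ^+ k.
(* More than [C ^+ k] points, each worth [m = M / C ^+ k], add up to more than [M]. *)
have [s [sn ss sx]] := sep (Num.truncn (C ^+ k)).+1.
have : (((size s)%:R * m)%:E <= mu (ball x (r + e)))%E.
  apply: (@measure_separated e) => //.
  - exact: borel_ball.
  - move=> y /sx; rewrite ballE => xy z; rewrite !ballE => yz.
    by have := metric_triangle x y z; move: xy yz;
      set a := mdist x y; set b := mdist y z => *; lra.
  - move=> y /sx; rewrite ballE => xy.
    rewrite /m ler_pdivrMr ?exprn_gt0// mulrC; apply: le_trans (HC y (e / 2) k e20).
    apply: ball_measure_le; first by rewrite mulr_gt0 ?exprn_gt0.
    move=> z; rewrite !ballE => xz; apply: lt_trans kP.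
    have := metric_triangle y x z; rewrite (metric_sym y x).
    by move: xy xz; set a := mdist x y; set b := mdist x z => *; lra.
rewrite ball_measure_fin// lee_fin sn -/M /m mulrCA ger_pMr// ler_pdivrMr ?exprn_gt0//.
by rewrite mul1r leNgt truncnS_gt.
Qed.

Lemma metric_closureP (A : set X) (x : X) :
  closure A x <-> forall e, 0 < e -> exists2 y, A y & mdist x y < e.
Proof.
split=> [clA e e0|h B /nbhs_ballP[e /= e0 eB]].
  have [y [Ay]] := clA _ (nbhsx_ballx x e e0).
  by rewrite ballE; exists y.
by have [y Ay xy] := h e e0; exists y; split => //; apply: eB; rewrite ballE.
Qed.

(** An ultrafilter containing a finite union of small balls contains one of them; so ultrafilters on
    a bounded set are Cauchy, and completeness makes them converge. *)
Lemma bounded_closed_compact (A : set X) : closed A -> metric_bounded A -> compact A.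
Proof.
move=> clA [x [r Ar]]; rewrite compact_ultra => F FU FA.
have r'0 : 0 < Num.max r 1 by rewrite lt_max ltr01 orbT.
have : cauchy F.
  apply: cauchy_exP => e e0.
  have [s sP] := ball_totally_bounded x r'0 e0.
  have : F (\bigcup_(y in [set` s]) ball y e).
    apply: filterS FA => y /Ar; rewrite ballE => xy; apply: sP.
    by rewrite ballE (lt_le_trans xy)// le_max lexx.
  elim: s {sP} => [|y s ih] Fs.
    have : F set0 by apply: filterS Fs => z [].
    by move=> /(@filter_not_empty _ F).
  have [Fy|Fny] := in_ultra_setVsetC (ball y e) FU; first by exists y.
  apply: ih; apply: filterS (filterI Fs Fny) => z [[w /=]].
  by rewrite inE => /predU1P[->//|ws wz _]; exists w.
move=> /cauchy_cvg /cvg_ex[l Fl].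
exists l; split => //.
apply: clA => B /Fl FB.
by have [z] := @filter_ex _ F _ _ (filterI FA (FB : F B)); exists z.
Qed.
End properness.
(** * Quasiconvexity *)

Section test_functions.
Context {R : realType} {X : completeMetricType R}.
Variables (mu : borel_measure X R) (p : R).
Hypotheses (mu_balls : finite_positive_on_balls mu) (p1 : 1 <= p).
Variables (v : X -> R) (eps M : R) (x0 : X).
Hypotheses (eps0 : 0 < eps) (M0 : 0 < M).
Hypothesis v_lip : forall y z, mdist y z < eps -> `|v y - v z| <= mdist y z.
Hypothesis v_bnd : forall y, 0 <= v y <= M.
Hypothesis v_supp : forall y, 0 < v y -> mdist x0 y < M.
Local Notation leb := (@lebesgue_measure R).
Let B : set X := ball x0 M.
Let u (y : X) := (v y)%:E.

(** The bound for [v] holds only below scale [eps], but along arc length steps of length [eps / 2]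
    add up without loss. *)
Lemma along_curve_lip (c : rect_curve X) s t : s <= t ->
  `|v (clamp_curve c t) - v (clamp_curve c s)| <= t - s.
Proof.
have e0 := eps0.
have step (a b : R) : a <= b -> b - a < eps ->
    `|v (clamp_curve c b) - v (clamp_curve c a)| <= b - a.
  move=> ab abe.
  have h : mdist (clamp_curve c b) (clamp_curve c a) <= b - a.
    by apply: le_trans (dist_clamp_curve_le _ _ _) _; rewrite distrC ger0_norm ?subr_ge0.
  by apply: (le_trans _ h); apply: v_lip; exact: le_lt_trans h abe.
have main n (a b : R) : a <= b -> b - a <= n%:R * (eps / 2) ->
    `|v (clamp_curve c b) - v (clamp_curve c a)| <= b - a.
  elim: n a b => [|n ih] a b ab.
    rewrite mul0r => h; apply: step => //; lra.
  rewrite -[n.+1]addn1 natrD mulrDl mul1r => h.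
  pose m := Num.max a (b - eps / 2).
  have am : a <= m by rewrite le_max lexx.
  have mb : m <= b by rewrite ge_max ab; lra.
  have bm : b - m <= eps / 2.
    by have : b - eps / 2 <= m by [rewrite le_max lexx orbT]; lra.
  have h1 : `|v (clamp_curve c b) - v (clamp_curve c m)| <= b - m.
    by apply: step => //; lra.
  have h2 : `|v (clamp_curve c m) - v (clamp_curve c a)| <= m - a.
    apply: ih => //; rewrite /m; case: (leP a (b - eps / 2)) => ba; first lra.
    by rewrite subrr mulr_ge0// divr_ge0// ltW.
  have -> : v (clamp_curve c b) - v (clamp_curve c a) =
    (v (clamp_curve c b) - v (clamp_curve c m)) +
    (v (clamp_curve c m) - v (clamp_curve c a)) by ring.
  by apply: le_trans (ler_normD _ _) _; lra.
move=> st; apply: (main (Num.truncn ((t - s) / (eps / 2))).+1) => //.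
by rewrite -ler_pdivrMr ?divr_gt0// ltW// truncnS_gt.
Qed.

Lemma test_fun_supp y : ~ B y -> v y = 0.
Proof.
rewrite /B ballE => h; apply/eqP; rewrite eq_le; have /andP[-> _] := v_bnd y.
by rewrite andbT leNgt; apply/negP => /v_supp.
Qed.

Let g (y : X) : \bar R := (\1_B y)%:E.

Let mg : measurable_fun [set: borel X] g.
Proof. by apply/measurable_EFinP; apply: measurable_indic; exact: borel_ball. Qed.

Let g0 y : (0 <= g y)%E.
Proof. by rewrite lee_fin. Qed.

Let integral_g_ge (c : rect_curve X) (s t : R) : 0 <= s -> s <= t -> t <= len c ->
  (forall x, s < x < t -> B (clamp_curve c x)) ->
  ((t - s)%:E <= line_integral c g)%E.
Proof.
move=> s0 st tl sB; have [->|st'] := eqVneq s t.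
  by rewrite subrr; apply: integral_ge0.
have {}st : s < t by rewrite lt_neqAle st' st.
rewrite line_integral_clamp.
apply: (@le_trans _ _ (\int[leb]_(x in `]s, t[) g (clamp_curve c x))%E).
  rewrite (_ : (\int[leb]_(x in `]s, t[) g (clamp_curve c x) = \int[leb]_(x in `]s, t[)
    1)%E); last first.
    by apply: eq_integral => x; rewrite inE/= in_itv/= => /sB h;
      rewrite /g indicE mem_set.
  by rewrite integral_cst// mul1e [X in (_ <= X)%E]lebesgue_measure_itv/= lte_fin st
    EFinB.
apply: ge0_subset_integral => //.
  by apply: measurable_funTS; exact: measurable_clamp_curve.
move=> x /=; rewrite !in_itv/= => /andP[sx xt].
by rewrite (le_trans s0 (ltW sx)) (le_trans (ltW xt) tl).
Qed.

(** If the curve leaves [B], then [v] at its start is at most the first exit time [inf T], and [v]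
    at its end is at most [len c - sup T], the time since the last return; during both periods the
    curve runs in [B]. As [v] is nonnegative, the larger of the two values bounds the difference. *)
Lemma test_fun_upper_gradient : upper_gradient u g.
Proof.
split=> [|c]; first by split.
apply/upper_gradient_ineqE.
have l0 := ltW (len_gt0 c).
rewrite -(clamp_curveE (t := 0)) ?lexx// -(clamp_curveE (t := len c)) ?lexx ?l0//.
pose T := [set t | 0 <= t <= len c /\ ~ B (clamp_curve c t)].
have [[t0 t0T]|nT] := pselect (T !=set0); last first.
  apply: (@le_trans _ _ (len c - 0)%:E).
    by rewrite lee_fin distrC; exact: along_curve_lip.
  apply: integral_g_ge => // x /andP[x1 x2]; apply: contrapT => h; apply: nT.
  by exists x; split => //; rewrite !ltW.
have Tl : has_lbound T by exists 0 => t [/andP[]].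
have Tu : has_ubound T by exists (len c) => t [/andP[]].
have T0 : T !=set0 by exists t0.
have i0 : 0 <= inf T by apply: lb_le_inf => // t [/andP[]].
have sl : sup T <= len c by apply: ge_sup => // t [/andP[]].
have il : inf T <= len c.
  by case: (t0T) => /andP[_ t0l] _; apply: le_trans t0l; exact: ge_inf.
have s0 : 0 <= sup T.
  by case: (t0T) => /andP[t00 _] _; apply: le_trans t00 _; exact: ub_le_sup.
have v0 y := proj1 (andP (v_bnd y)).
have h1 : v (clamp_curve c 0) <= inf T.
  apply: lb_le_inf => // t [/andP[t00 _] /test_fun_supp vt].
  have := along_curve_lip c t00; rewrite vt sub0r normrN subr0.
  by apply: le_trans; exact: ler_norm.
have h2 : v (clamp_curve c (len c)) <= len c - sup T.
  rewrite lerBrDr -lerBrDl; apply: ge_sup => // t [/andP[_ tl] /test_fun_supp vt].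
  have := along_curve_lip c tl; rewrite vt subr0 => h.
  by rewrite lerBrDl -lerBrDr; apply: le_trans h; exact: ler_norm.
have I1 : ((inf T)%:E <= line_integral c g)%E.
  rewrite -[inf T]subr0; apply: integral_g_ge => // x /andP[x1 x2].
  apply: contrapT => h; have : inf T <= x.
    by apply: ge_inf => //; split => //; rewrite (ltW x1) (le_trans (ltW x2)).
  by rewrite leNgt x2.
have I2 : ((len c - sup T)%:E <= line_integral c g)%E.
  apply: integral_g_ge => // x /andP[x1 x2].
  apply: contrapT => h; have : x <= sup T.
    by apply: ub_le_sup => //; split => //; rewrite (ltW x2) (le_trans s0 (ltW x1)).
  by rewrite leNgt x1.
have [h|h] := leP (v (clamp_curve c (len c))) (v (clamp_curve c 0)).
  apply: le_trans I1; rewrite lee_fin ger0_norm ?subr_ge0//.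
  by apply: le_trans h1; rewrite gerBl.
apply: le_trans I2; rewrite lee_fin ltr0_norm ?subr_lt0// opprB.
by apply: le_trans h2; rewrite gerBl.
Qed.

Lemma measurable_test_fun : measurable_fun [set: borel X] v.
Proof.
apply: (measurability _ (RGenOInfty.measurableE R)).
move=> _ [_ [a ->] <-]; rewrite setTI; apply: borel_open.
rewrite openE => y /=; rewrite in_itv/= andbT => ay.
apply/nbhs_ballP; exists (Num.min eps (v y - a)) => /=.
  by rewrite lt_min eps0 subr_gt0.
move=> z; rewrite ballE lt_min => /andP[yz yz2] /=; rewrite in_itv/= andbT.
by have := v_lip yz; rewrite ler_norml => /andP[_]; lra.
Qed.

Let integral_g : (\int[mu]_x (g x `^ p) < +oo)%E.
Proof.
rewrite (_ : (\int[mu]_x (g x `^ p) = \int[mu]_x g x)%E); last first.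
  apply: eq_integral => x _; rewrite /g indicE; case: (x \in B).
    by rewrite poweR1r.
  by rewrite poweR0r// gt_eqF// (lt_le_trans _ p1).
rewrite integral_indic//; last exact: borel_ball.
by rewrite setIT; have /andP[] := mu_balls x0 M0.
Qed.

Lemma test_fun_newtonian : newtonian mu p u.
Proof.
split.
  exists u; last exact: aeW.
  by apply/measurable_EFinP; exact: measurable_test_fun.
rewrite lte_add_pinfty//.
  apply: (@le_lt_trans _ _ (\int[mu]_x ((M `^ p)%:E * g x))%E).
    apply: ge0_le_integral => //.
    - by move=> x _; exact: poweR_ge0.
    - apply: measurable_fun_poweR; apply: measurableT_comp => //.
      by apply/measurable_EFinP; exact: measurable_test_fun.
    - by apply: emeasurable_funM => //; exact: measurable_cst.
    move=> x _; rewrite /g indicE; case: (boolP (x \in B)) => [_|].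
      rewrite mule1 -poweR_EFin; apply: le_poweR => //; first exact: le_trans p1.
      by have /andP[h0 hM] := v_bnd x; rewrite lee_fin ger0_norm.
    rewrite notin_setE => /test_fun_supp vx.
    by rewrite mule0 /u vx abse0 poweR0r// gt_eqF// (lt_le_trans _ p1).
  rewrite ge0_integralZl// ?lee_fin ?powR_ge0//.
  rewrite lte_mul_pinfty// ?lee_fin ?powR_ge0//.
  rewrite integral_indic//; last exact: borel_ball.
  by rewrite setIT; have /andP[] := mu_balls x0 M0.
apply: le_lt_trans integral_g; apply: ereal_inf_lbound.
by exists g => //; exact: test_fun_upper_gradient.
Qed.

(** The indicator [g] is a competitor, so the minimal weak upper gradient is at most [g] almost
    everywhere. *)
Lemma test_fun_minimal : exists2 h : X -> \bar R,
  minimal_weak_upper_gradient mu p u h & {ae mu, forall x, (h x <= 1)%E}.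
Proof.
have wg : weak_upper_gradient mu p u g.
  have [ng ig] := test_fun_upper_gradient; split => //.
  (* A genuine upper gradient has an empty exceptional family, for which the zero function is a
     witness. *)
  exists (cst 0%E); split.
  - by split => //; exact: measurable_cst.
  - under eq_integral do rewrite poweR0r ?gt_eqF ?(lt_le_trans _ p1)//.
    by rewrite integral0.
  - by move=> c /(_ (ig c)).
have [h hP] := minimal_weak_upper_gradient_exists p1 wg integral_g.
exists h => //; have [_ _ hmin] := hP.
have := hmin _ wg integral_g;
  apply: (@filterS _ _ (ae_filter_ringOfSetsType mu)) => x hx; apply: le_trans hx _.
by rewrite /g indicE lee_fin; case: (_ \in _).
Qed.

End test_functions.

(** * The Poincare inequality as a Lipschitz estimate uniform in [eps] *)

Section poincare_lipschitz.
Context {R : realType} {X : completeMetricType R}.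
Variables (mu : borel_measure X R) (p : R).
Hypotheses (mu_balls : finite_positive_on_balls mu) (p1 : 1 <= p).
Hypotheses (mu_doubling : doubling mu) (X_poincare : poincare mu p).

Definition test_function (eps M : R) (x0 : X) (v : X -> R) :=
  [/\ forall y z, mdist y z < eps -> `|v y - v z| <= mdist y z,
      forall y, 0 <= v y <= M & forall y, 0 < v y -> mdist x0 y < M].

Definition mean (v : X -> R) (x : X) (r : R) : R :=
  (fine (mu (ball x r)))^-1 * \int[mu]_(y in ball x r) v y.

Let mB x r := borel_ball (x : X) (r : R).

Section fixed_test_function.
Variables (eps M : R) (x0 : X) (v : X -> R).
Hypotheses (eps0 : 0 < eps) (M0 : 0 < M) (tv : test_function eps M x0 v).

Let mv : measurable_fun [set: borel X] v.
Proof. by have [lip _ _] := tv; exact: measurable_test_fun eps0 lip. Qed.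

Lemma integrable_test_fun (x : X) (r a : R) : 0 < r ->
  mu.-integrable (ball x r) (EFin \o (fun y => v y - a)).
Proof.
move=> r0; apply: measurable_bounded_integrable.
- exact: mB.
- by have /andP[] := mu_balls x r0.
- by apply: measurable_funTS; apply: measurable_funB => //; exact: measurable_cst.
exists (M + `|a|); split; first exact: num_real.
move=> N MN y _ /=; apply: le_trans (ltW MN); apply: le_trans (ler_normB _ _) _.
have [_ /(_ y)/andP[v0 vM] _] := tv.
by rewrite lerD2r ger0_norm.
Qed.

Lemma integrable_test_fun0 (x : X) (r : R) : 0 < r ->
  mu.-integrable (ball x r) (EFin \o v).
Proof.
move=> r0; have := integrable_test_fun x 0 r0.
by apply: eq_integrable; [exact: mB|move=> y _ /=; rewrite subr0].
Qed.

Lemma integrable_norm_test_fun (x : X) (r a : R) : 0 < r ->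
  mu.-integrable (ball x r) (EFin \o (fun y => `|v y - a|)).
Proof.
move=> r0; have /integrable_abse := integrable_test_fun x a r0.
by apply: eq_integrable; first exact: mB.
Qed.

Lemma averageE (x : X) (r : R) : 0 < r ->
  average mu (ball x r) (fun y => (v y)%:E) = (mean v x r)%:E.
Proof.
move=> r0; rewrite /average /mean /Rintegral EFinM fineK//.
by apply: integrable_fin_num; [exact: mB|exact: integrable_test_fun0].
Qed.

Lemma mean_sub (x : X) (r a : R) : 0 < r ->
  mean v x r - a = (fine (mu (ball x r)))^-1 * \int[mu]_(y in ball x r) (v y - a).
Proof.
move=> r0; have m0 := ball_measure_gt0 mu_balls x r0.
rewrite RintegralB//; last 2 first.
- exact: integrable_test_fun0.
- apply: measurable_bounded_integrable.
  + exact: mB.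
  + by have /andP[] := mu_balls x r0.
  + exact: measurable_cst.
  + by exists `|a|; split; [exact: num_real|move=> N aN y _; exact: ltW].
rewrite Rintegral_cst; last exact: mB.
by rewrite /mean mulrBr (mulrC a) mulKf// gt_eqF.
Qed.

Lemma mean_close (x : X) (r a e : R) : 0 < r ->
  (forall y, mdist x y < r -> `|v y - a| <= e) -> `|mean v x r - a| <= e.
Proof.
move=> r0 h; have m0 := ball_measure_gt0 mu_balls x r0.
rewrite mean_sub// normrM gtr0_norm ?invr_gt0// ler_pdivrMl//.
apply: le_trans (le_normr_Rintegral (mB _ _) (integrable_test_fun x a r0)) _.
rewrite mulrC -Rintegral_cst; last exact: mB.
apply: le_Rintegral; first exact: mB.
- exact: integrable_norm_test_fun.
- apply: measurable_bounded_integrable.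
  + exact: mB.
  + by have /andP[] := mu_balls x r0.
  + exact: measurable_cst.
  + by exists `|e|; split; [exact: num_real|move=> N aN y _; exact: ltW].
by move=> y; rewrite ballE => /h.
Qed.

Lemma mean_oscillation_sub (K D : R) (z : X) (s : R) (w : X) (r : R) : 0 < s ->
  0 < r -> 0 <= D ->
  ball z s `<=` ball w r ->
  fine (mu (ball w r)) <= K * fine (mu (ball z s)) ->
  \int[mu]_(y in ball w r) `|v y - mean v w r| <= fine (mu (ball w r)) * D ->
  `|mean v z s - mean v w r| <= K * D.
Proof.
move=> s0 r0 D0 zw mK osc; have m0 := ball_measure_gt0 mu_balls z s0.
rewrite mean_sub// normrM gtr0_norm ?invr_gt0// ler_pdivrMl//.
apply: le_trans (le_normr_Rintegral (mB _ _) (integrable_test_fun z (mean v w r) s0)) _.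
apply: (@le_trans _ _ (\int[mu]_(y in ball w r) `|v y - mean v w r|)).
  apply: fine_le.
  - by apply: integrable_fin_num; [exact: mB|exact: integrable_norm_test_fun].
  - by apply: integrable_fin_num; [exact: mB|exact: integrable_norm_test_fun].
  apply: ge0_subset_integral => //.
    by have /integrableP[] := integrable_norm_test_fun w (mean v w r) r0.
apply: le_trans osc _; rewrite mulrA ler_wpM2r//.
by rewrite (le_trans mK)// mulrC.
Qed.

Lemma diam_ball_le (x : X) (r : R) : 0 < r -> (0 <= diam (ball x r) <= (2 * r)%:E)%E.
Proof.
move=> r0; apply/andP; split.
  apply: ereal_sup_ubound; exists (x, x); last by rewrite /= mdistxx.
  by split => /=; exact: ballxx.
apply: ub_ereal_sup => _ [[y z] /= [+ +] <-]; rewrite !ballE lee_fin => xy xz.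
have := metric_triangle y x z; rewrite (metric_sym y x).
by move: xy xz; set a := mdist x y; set b := mdist x z => *; lra.
Qed.

End fixed_test_function.

(** A gradient bounded by 1 has averages at most 1 on every ball, so the dilation [lam] disappears
    and only the diameter, at most [2 * r], remains. The constant depends on neither [eps] nor the
    function. *)
Lemma poincare_test_fun : exists2 C : R, 0 < C & forall (eps M : R) (x0 : X) (v : X -> R),
  0 < eps -> 0 < M -> test_function eps M x0 v -> forall (x : X) (r : R), 0 < r ->
  \int[mu]_(y in ball x r) `|v y - mean v x r| <= fine (mu (ball x r)) * (C * r).
Proof.
have [C [lam [C0 lam1 PI]]] := X_poincare.
exists (2 * C) => [|eps M x0 v eps0 M0 tv x r r0]; first by rewrite mulr_gt0.
have m0 := ball_measure_gt0 mu_balls x r0.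
have [tv1 tv2 tv3] := tv.
have [h hmin h1] := test_fun_minimal mu_balls p1 eps0 M0 tv1 tv2 tv3.
have nu := test_fun_newtonian mu_balls p1 eps0 M0 tv1 tv2 tv3.
have := PI x r _ h r0 nu hmin.
rewrite (averageE eps0 tv x r0).
have -> : average mu (ball x r) (fun y => `|(v y)%:E - (mean v x r)%:E|)%E =
    ((fine (mu (ball x r)))^-1 * \int[mu]_(y in ball x r) `|v y - mean v x r|)%:E.
  rewrite [RHS]EFinM /average /Rintegral fineK//.
  apply: integrable_fin_num; first exact: mB.
  exact: (integrable_norm_test_fun eps0 tv x (mean v x r) r0).
have [[[mh h0] _] _ _] := hmin.
have lr0 : 0 < lam * r by rewrite mulr_gt0// (lt_le_trans _ lam1).
have mlr := ball_measure_gt0 mu_balls x lr0.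
have a1 : (average mu (ball x (lam * r)) (fun y => h y `^ p) <= 1)%E.
  rewrite /average.
  apply: (@le_trans _ _
    ((fine (mu (ball x (lam * r))))^-1%:E * \int[mu]_(y in ball x (lam * r)) 1)%E).
    rewrite lee_wpmul2l ?lee_fin ?invr_ge0 ?(ltW mlr)//.
    apply: ae_ge0_le_integral => //.
    - by move=> y _; exact: poweR_ge0.
    - by apply: measurable_funTS; exact: measurable_fun_poweR.
    - apply: (@filterS _ _ (ae_filter_ringOfSetsType mu)) h1 => y hy _.
      rewrite -(poweR1r p); apply: le_poweR => //; exact: le_trans p1.
  rewrite integral_cst; last exact: mB.
  rewrite mul1e (ball_measure_fin mu_balls x lr0) -EFinM mulVf// gt_eqF//.
have a0 : (0 <= average mu (ball x (lam * r)) (fun y => h y `^ p))%E.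
  rewrite /average mule_ge0 ?lee_fin ?invr_ge0 ?(ltW mlr)//.
  by apply: integral_ge0 => y _; exact: poweR_ge0.
have /andP[d0 d2] := diam_ball_le x r0.
move=> H; have {H} : (((fine (mu (ball x r)))^-1 * \int[mu]_(y in ball x r) `|v y -
  mean v x r|)%:E
    <= (C * (2 * r))%:E)%E.
  apply: le_trans H _; rewrite -[leRHS]mule1 EFinM; apply: lee_pmul.
  - by rewrite mule_ge0// lee_fin ltW.
  - exact: poweR_ge0.
  - by rewrite lee_wpmul2l// lee_fin ltW.
  - rewrite -(poweR1r p^-1); apply: le_poweR => //; rewrite invr_ge0; exact: le_trans p1.
rewrite lee_fin ler_pdivrMl// => /le_trans; apply.
by rewrite ler_pM2l// mulrA (mulrC C).
Qed.

(* Telescoping the means over the balls B(x, 2^-n r) and B(y, 2^-n r). *)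
Lemma test_fun_lipschitz : exists2 K : R,
  0 < K & forall (eps M : R) (x0 : X) (v : X -> R),
  0 < eps -> 0 < M -> test_function eps M x0 v ->
  forall x y, `|v x - v y| <= K * mdist x y.
Proof.
have [C C0 HC] := poincare_test_fun.
have [D D0 HD] := doublingR mu_balls mu_doubling.
(* [K0] is the price of halving a radius. [K1] is the price of passing from [ball y r] to
   [ball x (2 * r)], whose measures compare through two doublings, via the ball of radius [4 * r]
   around [y]. *)
pose K0 := D * C.
have K00 : 0 < K0 by rewrite mulr_gt0.
pose K1 := D * D * (2 * C).
have K10 : 0 < K1 by rewrite !mulr_gt0.
(* Two points are compared with their means at radius [r]; then come one halving from [2 * r] at [x]
   and one change of centre from [y]. *)
exists (2 * (1 + 2 * K0) + 2 * K0 + K1);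
  first by rewrite !addr_gt0 ?mulr_gt0// ?addr_gt0// mulr_gt0.
move=> eps M x0 v eps0 M0 tv x y.
have [->|xy] := eqVneq x y; first by rewrite subrr normr0 mdistxx mulr0.
have osc := HC _ _ _ _ eps0 M0 tv.
have half (z : X) (s : R) : 0 < s -> `|mean v z (s / 2) - mean v z s| <= K0 * s.
  move=> s0; have s20 : 0 < s / 2 by rewrite divr_gt0.
  rewrite /K0 -mulrA; apply: (mean_oscillation_sub eps0 tv) => //.
  - by rewrite mulr_ge0// ltW.
  - by apply: le_ball; lra.
  - by have := HD z (s / 2) s20; rewrite mulrC divfK.
  - exact: osc.
have tel (z : X) (s : R) n : 0 < s ->
  `|mean v z (s / 2 ^+ n) - mean v z s| <= 2 * K0 * (s - s / 2 ^+ n).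
  move=> s0; elim: n => [|n ih]; first by rewrite expr0 divr1 !subrr normr0 mulr0.
  set q := s / 2 ^+ n in ih *.
  have -> : s / 2 ^+ n.+1 = q / 2 by rewrite exprSr invfM mulrA.
  have q0 : 0 < q by rewrite divr_gt0// exprn_gt0.
  have := half z q q0.
  have -> : mean v z (q / 2) - mean v z s = (mean v z (q / 2) - mean v z q) +
    (mean v z q - mean v z s) by ring.
  move=> hq; apply: le_trans (ler_normD _ _) _; move: hq ih; nra.
have point (z : X) (s : R) : 0 < s -> `|v z - mean v z s| <= (1 + 2 * K0) * s.
  (* [n] halvings bring the radius below [eps], where [v] is 1-Lipschitz and the mean is close to
     [v z]; the bound for the geometric sum of the prices is free of [n]. *)
  move=> s0; pose n := (Num.truncn (s / eps)).+1.
  have ne : s / 2 ^+ n < eps.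
    rewrite ltr_pdivrMr ?exprn_gt0// mulrC -ltr_pdivrMr//.
    by apply: lt_trans (truncnS_gt _) _; rewrite -natrX ltr_nat ltn_expl.
  have q0 : 0 < s / 2 ^+ n by rewrite divr_gt0// exprn_gt0.
  have qs : s / 2 ^+ n <= s by rewrite ler_pdivrMr ?exprn_gt0// ler_peMr ?(ltW s0)//
    exprn_ege1// ler1n.
  have h1 : `|mean v z (s / 2 ^+ n) - v z| <= s / 2 ^+ n.
    apply: (mean_close eps0 tv) => // w zw; have [lip _ _] := tv.
    rewrite distrC; apply: le_trans (ltW zw); apply: lip; exact: lt_trans ne.
  have h2 := tel z s n s0.
  have -> : v z - mean v z s = - (mean v z (s / 2 ^+ n) - v z) +
    (mean v z (s / 2 ^+ n) - mean v z s) by ring.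
  apply: le_trans (ler_normD _ _) _; rewrite normrN.
  by move: h1 h2 q0 qs; set a := s / 2 ^+ n => *; nra.
pose r := mdist x y; have r0 : 0 < r by rewrite mdist_gt0.
have r20 : 0 < 2 * r by rewrite mulr_gt0.
have h1 := point x r r0; have h2 := point y r r0.
have h3 : `|mean v x r - mean v x (2 * r)| <= 2 * K0 * r.
  have := half x (2 * r) r20; rewrite mulrC mulKf ?pnatr_eq0//; move=> /le_trans; apply.
  by rewrite mulrCA mulrA.
have h4 : `|mean v y r - mean v x (2 * r)| <= K1 * r.
  rewrite (_ : K1 * r = D * D * (C * (2 * r))); last by rewrite /K1; ring.
  apply: (mean_oscillation_sub eps0 tv) => //.
  - by rewrite mulr_ge0// ltW.
  - move=> z; rewrite !ballE => yz; have := metric_triangle x y z; rewrite -/r.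
    by move: yz; set a := mdist y z => *; lra.
  - apply: (@le_trans _ _ (fine (mu (ball y (2 * (2 * r)))))).
      apply: (ball_measure_le mu_balls); first by rewrite mulr_gt0.
      move=> z; rewrite !ballE => xz; have := metric_triangle y x z;
        rewrite (metric_sym y x) -/r.
      by move: xz r0; set a := mdist x z => *; lra.
    apply: le_trans (HD _ _ r20) _; rewrite -mulrA ler_pM2l//; exact: HD.
  - exact: osc.
have -> : v x - v y = (v x - mean v x r) + (mean v x r - mean v x (2 * r)) +
   - (mean v y r - mean v x (2 * r)) + - (v y - mean v y r) by ring.
rewrite -/r.
apply: le_trans (ler_normD _ _) _; rewrite normrN.
apply: le_trans (lerD (ler_normD _ _) (lexx _)) _; rewrite normrN.
apply: le_trans (lerD (lerD (ler_normD _ _) (lexx _)) (lexx _)) _.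
lra.
Qed.
End poincare_lipschitz.

(** * Chains with small steps and walks along them *)

Section chains.
Context {R : realType} {X : completeMetricType R}.

Fixpoint chain_length (x : X) (s : seq X) : R :=
  if s is y :: s' then mdist x y + chain_length y s' else 0.

Definition eps_chain (eps : R) (x : X) (s : seq X) :=
  path (fun a b => mdist a b < eps) x s.

Lemma chain_length_ge0 x s : 0 <= chain_length x s.
Proof. by elim: s x => [|y s ih] x //=; rewrite addr_ge0 ?mdist_ge0. Qed.

Lemma chain_length_rcons x s y :
  chain_length x (rcons s y) = chain_length x s + mdist (last x s) y.
Proof.
elim: s x => [|z s ih] x /=; first by rewrite add0r addr0.
by rewrite ih addrA.
Qed.

Lemma dist_last_le x s : mdist x (last x s) <= chain_length x s.
Proof.
elim: s x => [|z s ih] x /=; first by rewrite mdistxx.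
by apply: le_trans (metric_triangle x z _) _; rewrite lerD2l.
Qed.

(** The vertex reached after walking a length [tau]: a step function of [tau] that waits at a vertex
    until the whole next step is paid for. *)
Fixpoint chain_walk (x : X) (s : seq X) (tau : R) : X :=
  if s is y :: s' then
    if mdist x y <= tau then chain_walk y s' (tau - mdist x y) else x
  else x.

Lemma chain_walk_dist x s tau : 0 <= tau -> mdist x (chain_walk x s tau) <= tau.
Proof.
elim: s x tau => [|z s ih] x tau t0 /=; first by rewrite mdistxx.
case: ifPn => [xz|_]; last by rewrite mdistxx.
apply: le_trans (metric_triangle x z _) _; rewrite -lerBrDl; apply: ih.
by rewrite subr_ge0.
Qed.

Lemma chain_walk_length x s tau : mdist x (chain_walk x s tau) <= chain_length x s.
Proof.
elim: s x tau => [|z s ih] x tau /=; first by rewrite mdistxx.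
case: ifPn => [xz|_]; last by rewrite mdistxx addr_ge0 ?mdist_ge0// chain_length_ge0.
by apply: le_trans (metric_triangle x z _) _; rewrite lerD2l.
Qed.

Lemma chain_walk_last x s tau : chain_length x s <= tau -> chain_walk x s tau = last x s.
Proof.
elim: s x tau => [|z s ih] x tau //= h.
have xz : mdist x z <= tau by apply: le_trans h; rewrite lerDl chain_length_ge0.
by rewrite xz; apply: ih; rewrite lerBrDl.
Qed.

Lemma chain_walk_lip (eps : R) x s t t' : 0 < eps -> eps_chain eps x s ->
  0 <= t -> t <= t' -> mdist (chain_walk x s t) (chain_walk x s t') <= t' - t + eps.
Proof.
move=> e0; elim: s x t t' => [|z s ih] x t t' /=.
  by move=> _ _ tt'; rewrite mdistxx addr_ge0 ?subr_ge0// ltW.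
move=> /andP[xz zs] t0 tt'; have [zt|tz] := leP (mdist x z) t.
  rewrite (le_trans zt tt'); apply: le_trans (ih _ _ _ zs _ _) _.
  - by rewrite subr_ge0.
  - by rewrite lerD2r.
  - by rewrite lerD2r le_eqVlt; apply/orP; left; apply/eqP; ring.
have [zt'|_] := leP (mdist x z) t'; last first.
  by rewrite mdistxx addr_ge0 ?subr_ge0// ltW.
apply: le_trans (metric_triangle x z _) _.
have : mdist z (chain_walk z s (t' - mdist x z)) <= t' - mdist x z.
  by apply: chain_walk_dist; rewrite subr_ge0.
by move: xz tz zt'; set a := mdist x z; set b := mdist z _ => *; lra.
Qed.

Section chain_function.
Variables (eps M : R) (x0 : X).
Hypothesis M0 : 0 < M.

Definition chain_values (y : X) : set R :=
  [set t | t = 0 \/ exists2 s,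
    eps_chain eps x0 s /\ last x0 s = y & t = M - chain_length x0 s].

(* The truncated function max(M - d(y), 0), with d(y) the infimum of the
   lengths of the eps-chains from x0 to y; 0 stands for "no chain". *)
Definition chain_fun (y : X) : R := sup (chain_values y).

Let has_sup_values y : has_sup (chain_values y).
Proof.
split; first by exists 0; left.
exists M => t [->|[s _ ->]]; first exact: ltW.
by rewrite gerBl chain_length_ge0.
Qed.

Lemma chain_fun_ge y s : eps_chain eps x0 s -> last x0 s = y ->
  M - chain_length x0 s <= chain_fun y.
Proof.
by move=> es sy; apply: sup_upper_bound; [exact: has_sup_values|right; exists s].
Qed.

Lemma chain_fun_gt0 y : 0 < chain_fun y ->
  exists s, [/\ eps_chain eps x0 s, last x0 s = y & chain_length x0 s < M].
Proof.
move=> /(sup_gt (proj1 (has_sup_values y)))[t [->|[s [es sy] ->]]].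
  by rewrite ltxx.
by rewrite subr_gt0 => h; exists s.
Qed.

(** A chain to [y] extends to any [z] within [eps] of [y] at the cost of [mdist y z]; exchanging [y]
    and [z] gives the bound at scale [eps]. *)
Lemma chain_fun_test : test_function eps M x0 chain_fun.
Proof.
have f0 y : 0 <= chain_fun y.
  by apply: sup_upper_bound; [exact: has_sup_values|left].
have lip y z : mdist y z < eps -> chain_fun y - mdist y z <= chain_fun z.
  move=> yz; rewrite lerBlDr; apply: ge_sup; first by case: (has_sup_values y).
  move=> t [->|[s [es sy] ->]]; first by rewrite addr_ge0// mdist_ge0.
  rewrite -lerBlDr -addrA -opprD.
  rewrite (_ : chain_length x0 s + mdist y z = chain_length x0 (rcons s z)).
    by apply: chain_fun_ge; rewrite ?last_rcons// /eps_chain rcons_path sy yz andbT.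
  by rewrite chain_length_rcons sy.
split.
- move=> y z yz; rewrite ler_norml; have h1 := lip _ _ yz.
  by have := lip z y; rewrite metric_sym => /(_ yz) h2; apply/andP; split; lra.
- move=> y; rewrite f0/=; apply: ge_sup; first by case: (has_sup_values y).
  move=> t [->|[s _ ->]]; first exact: ltW.
  by rewrite gerBl chain_length_ge0.
- move=> y /chain_fun_gt0[s [_ <- h]]; exact: le_lt_trans (dist_last_le _ _) h.
Qed.
End chain_function.

End chains.

(** * From short chains to curves *)

Section quasiconvexity.
Context {R : realType} {X : completeMetricType R}.
Variables (mu : borel_measure X R) (p : R).
Hypotheses (mu_balls : finite_positive_on_balls mu) (p1 : 1 <= p).
Hypotheses (mu_doubling : doubling mu) (X_poincare : poincare mu p).

(** Truncate at height [M = 2 * K * mdist x y]. The chain function is at least [M] at [x], thanks to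
    the empty chain, and drops by at most [M / 2] on the way to [y]; being positive there, it yields
    a chain shorter than [M]. *)
Lemma short_chains : exists2 L : R, 0 < L & forall (x y : X) (eps : R),
  x != y -> 0 < eps ->
  exists s, [/\ eps_chain eps x s, last x s = y & chain_length x s < L * mdist x y].
Proof.
have [K K0 HK] := test_fun_lipschitz mu_balls p1 mu_doubling X_poincare.
exists (2 * K) => [|x y eps xy eps0]; first by rewrite mulr_gt0.
have d0 : 0 < mdist x y by rewrite mdist_gt0.
have M0 : 0 < 2 * K * mdist x y by rewrite !mulr_gt0.
apply: (chain_fun_gt0 M0).
have := HK _ _ _ _ eps0 M0 (@chain_fun_test R X eps _ x M0) x y.
have := @chain_fun_ge _ _ eps (2 * K * mdist x y) x M0 x [::] isT erefl.
rewrite /= subr0; set a := chain_fun _ _ _ x; set b := chain_fun _ _ _ y => ha.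
have Kd : 0 < K * mdist x y by rewrite mulr_gt0.
by rewrite ler_norml => /andP[_ hb]; move: ha hb Kd; rewrite -mulrA;
  set q := K * _ => *; lra.
Qed.

Lemma ultra_cvg (U : set_system nat) (g : nat -> X) (A : set X) :
  UltraFilter U -> compact A -> (forall n, A (g n)) ->
  exists2 l, A l & g @ U --> l.
Proof.
move=> UU cA gA; have [l [Al clu]] := cA (g @ U) _ (filterS (fun n _ => gA n) filterT).
exists l => // B lB; have [//|nB] := in_ultra_setVsetC (g @^-1` B) UU.
by have [z []] := clu (~` B) B nB lB.
Qed.

Lemma closed_cball (x : X) (r : R) : closed [set y | mdist x y <= r].
Proof.
move=> y cl /=; rewrite leNgt; apply/negP => ry.
have e0 : 0 < mdist x y - r by rewrite subr_gt0.
have [z []] := cl _ (nbhsx_ballx y _ e0).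
move=> /= xz; rewrite ballE metric_sym => yz.
by have := metric_triangle x z y; move: xz yz ry; set a := mdist x y;
  set b := mdist x z; set c := mdist z y => *; lra.
Qed.

Lemma compact_cball (x : X) (r : R) : compact [set y | mdist x y <= r].
Proof.
apply: (bounded_closed_compact mu_balls mu_doubling); first exact: closed_cball.
by exists x, (r + 1) => y /= h; rewrite ballE (le_lt_trans h)// ltrDl.
Qed.

(* An ultralimit of walks along finer and finer chains is a Lipschitz curve. *)
Lemma quasiconvex : exists2 L : R, 0 < L & forall (x y : X),
  exists f : R -> X, [/\ continuous f, f 0 = x, f 1 = y &
    forall t, mdist x (f t) <= L * mdist x y].
Proof.
have [L L0 HL] := short_chains; exists L => // x y.
have [<-|xy] := eqVneq x y.
  exists (cst x); split => //; first by move=> t; exact: cvg_cst.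
  by move=> t; rewrite mdistxx mulr0.
pose D := L * mdist x y.
have D0 : 0 < D by rewrite mulr_gt0// mdist_gt0.
have /choice[s sP] : forall n, exists s : seq X, [/\ eps_chain (n.+1%:R^-1) x s,
    last x s = y & chain_length x s < D].
  by move=> n; apply: HL => //; rewrite invr_gt0.
(* One ultrafilter provides limits for all real [t] at once, in place of a diagonal subsequence and
   an equicontinuity argument. *)
have [U [UU sU]] := @ultraFilterLemma nat \oo _.
have /choice[f fP] : forall t, exists l, mdist x l <= D /\
    (fun n => chain_walk x (s n) t) @ U --> l.
  move=> t; have wD n : [set z | mdist x z <= D] (chain_walk x (s n) t).
    apply: le_trans (chain_walk_length _ _ _) _.
    by have [_ _ /ltW] := sP n.
  by have [l ? ?] := ultra_cvg UU (@compact_cball x D) wD; exists l.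
have flip (t t' : R) : 0 <= t -> t <= t' -> mdist (f t) (f t') <= t' - t.
  move=> t0 tt'; apply/ler_addgt0Pr => e e0.
  have e30 : 0 < e / 3 by rewrite divr_gt0.
  have [_ /(@metricType_numDomainType.cvgr_dist_lt _ X) /(_ _ e30) h1] := fP t.
  have [_ /(@metricType_numDomainType.cvgr_dist_lt _ X) /(_ _ e30) h2] := fP t'.
  have h3 : U [set n | n.+1%:R^-1 < e / 3].
    by apply: sU; exact: near_infty_natSinv_lt (PosNum e30).
  have [n [[/= n1 n2] n3]] := @filter_ex _ U _ _ (filterI (filterI h1 h2) h3).
  have [es _ _] := sP n.
  have := chain_walk_lip (_ : 0 < n.+1%:R^-1) es t0 tt'.
  rewrite invr_gt0 ltr0Sn => /(_ isT).
  move: n1 n2 n3 => /=; set a := chain_walk _ _ t; set b := chain_walk _ _ t'.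
  have := metric_triangle (f t) a (f t'); have := metric_triangle a b (f t').
  rewrite (metric_sym b); set d1 := mdist _ _; set d2 := mdist _ _; set d3 := mdist _ _.
  by set d4 := mdist _ _; set d5 := mdist _ _; set m := n.+1%:R^-1 => *; lra.
have f0 : f 0 = x.
  apply/esym/mdist_positivity/eqP; rewrite eq_le mdist_ge0 andbT.
  apply/ler_addgt0Pr => e e0; rewrite add0r.
  have [_ /(@metricType_numDomainType.cvgr_dist_lt _ X) /(_ _ e0) h1] := fP 0.
  have [n /= n1] := @filter_ex _ U _ _ h1.
  have := chain_walk_dist x (s n) (lexx 0).
  have := metric_triangle x (chain_walk x (s n) 0) (f 0).
  rewrite (metric_sym (chain_walk _ _ _) (f 0)); move: n1.
  by set a := mdist _ _; set b := mdist _ _; set c := mdist _ _ => *; lra.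
have fD : f D = y.
  apply/mdist_positivity/eqP; rewrite eq_le mdist_ge0 andbT.
  apply/ler_addgt0Pr => e e0; rewrite add0r.
  have [_ /(@metricType_numDomainType.cvgr_dist_lt _ X) /(_ _ e0) h1] := fP D.
  have [n /= n1] := @filter_ex _ U _ _ h1.
  have [_ sy sD] := sP n.
  by apply: ltW; move: n1; rewrite chain_walk_last ?sy// ltW.
pose cl (t : R) : R := Num.max 0 (Num.min 1 t).
have cl01 (t : R) : 0 <= cl t <= 1.
  by rewrite /cl le_max lexx/= ge_max ler01 ge_min lexx.
have cl_le (t t' : R) : t <= t' -> 0 <= cl t' - cl t <= t' - t.
  move=> tt'; rewrite subr_ge0 /cl le_max2//= ?le_min2//=.
  rewrite lerBlDr ge_max; have /andP[c0 _] := cl01 t; rewrite -/(cl t).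
  have c1 : Num.min 1 t <= cl t by rewrite le_max lexx orbT.
  apply/andP; split; first by rewrite addr_ge0// subr_ge0.
  rewrite ge_min; move: c1; rewrite ge_min => /orP[c1|c1].
    by apply/orP; left; lra.
  by apply/orP; right; lra.
exists (fun t => f (D * cl t)); split.
- move=> t; apply/(@metricType_numDomainType.cvgrPdist_lt _ X) => e e0.
  have lip (a b : R) : mdist (f (D * cl a)) (f (D * cl b)) <= D * `|b - a|.
    wlog ab : a b / a <= b => [H|].
      by have [/H//|/ltW/H] := leP a b; rewrite metric_sym distrC.
    have /andP[h1 h2] := cl_le _ _ ab; have /andP[h3 _] := cl01 a.
    apply: le_trans (flip _ _ _ _) _.
    + by rewrite mulr_ge0// ltW.
    + by rewrite ler_pM2l// -subr_ge0.
    + by rewrite -mulrBr ler_pM2l// ger0_norm ?subr_ge0.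
  have eD : 0 < e / D by rewrite divr_gt0.
  near=> a; apply: le_lt_trans (lip _ _) _.
  rewrite mulrC -ltr_pdivlMr// distrC.
- by rewrite /cl min_r// max_l// mulr0.
- by rewrite /cl min_l// max_r// mulr1.
- by move=> t; have [] := fP (D * cl t).
Unshelve. all: by end_near. Qed.

End quasiconvexity.

(** * Joining points of open sets by curves *)

Section joining.
Context {R : realType} {X : completeMetricType R}.
Implicit Types (U V : set X) (x y z : X).

Lemma continuous_glue (f g : R -> X) (a : R) : continuous f -> continuous g ->
  f a = g a -> continuous (fun t => if t <= a then f t else g t).
Proof.
move=> cf cg fga t; apply/(@metricType_numDomainType.cvgrPdist_lt _ X) => e e0.
have /(@metricType_numDomainType.cvgr_dist_lt _ X) /(_ _ e0) hft := cf t.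
have /(@metricType_numDomainType.cvgr_dist_lt _ X) /(_ _ e0) hgt := cg t.
have [ta|ta|ta] := ltgtP t a.
- have ha : \forall s \near t, s < a by exact: lt_nbhsl.
  near=> s; have sa : s < a by near: s.
  by rewrite (ltW sa); near: s.
- have ha : \forall s \near t, a < s by exact: lt_nbhsr.
  near=> s; have sa : a < s by near: s.
  by rewrite leNgt sa; near: s.
- near=> s; case: ifPn => _; first by near: s.
  by rewrite ta fga -ta; near: s.
Unshelve. all: by end_near. Qed.

(** Curves are defined on all of [R] with all values in [U], so that gluing and reversing them
    involves no subspace topology. *)
Definition joined U x y := exists f : R -> X,
  [/\ continuous f, f 0 = x, f 1 = y & forall t, U (f t)].

Lemma joined_refl U x : U x -> joined U x x.
Proof. by move=> Ux; exists (cst x); split => // t; exact: cvg_cst. Qed.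

Lemma joined_trans U y x z : joined U x y -> joined U y z -> joined U x z.
Proof.
move=> [f [cf f0 f1 Uf]] [g [cg g0 g1 Ug]].
exists (fun t => if t <= 1 / 2 then f (2 * t) else g (2 * t - 1)); split.
- apply: continuous_glue.
  + by move=> t; apply: continuous_comp; [exact: mulrl_continuous|exact: cf].
  + move=> t; apply: continuous_comp; last exact: cg.
    apply: (@continuousB _ R^o); [exact: mulrl_continuous|exact: cvg_cst].
  + by rewrite mulrC divfK// f1 subrr g0.
- by rewrite divr_ge0// mulr0.
- have -> : ((1 : R) <= 1 / 2) = false by lra.
  by have -> : 2 * 1 - 1 = 1 :> R by ring.
- by move=> t; case: ifP.
Qed.

Lemma joined_sym U x y : joined U x y -> joined U y x.
Proof.
move=> [f [cf f0 f1 Uf]]; exists (fun t => f (1 - t)); split => //.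
- move=> t; apply: continuous_comp; last exact: cf.
  by apply: (@continuousB _ R^o); [exact: cvg_cst|exact: cvg_id].
- by rewrite subr0.
- by rewrite subrr.
Qed.

Lemma joined_connected_component U x y : joined U x y -> connected_component U x y.
Proof.
move=> [f [cf f0 f1 Uf]]; exists (range f); last by exists 1.
split; first by exists 0.
  by move=> _ [t _ <-].
apply: connected_continuous_connected; last exact: continuous_subspaceT.
by apply/connected_intervalP.
Qed.

Definition locally_joined := forall U, open U -> forall x, U x ->
  exists2 r : R, 0 < r & forall y, mdist x y < r -> joined U x y.

Lemma component_open U x : locally_joined -> open U -> open (connected_component U x).
Proof.
move=> lj oU; rewrite openE => y xy; have Uy := connected_component_sub xy.
have [r r0 rj] := lj U oU y Uy; apply/nbhs_ballP; exists r => // z.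
rewrite ballE => /rj/joined_connected_component; exact: connected_component_trans.
Qed.

(** The points of [U] joined to [x] form a set that is open and closed in [U], since nearby points
    can be joined. *)
Lemma connected_open_joined U x y : locally_joined -> open U -> connected U ->
  U x -> U y -> joined U x y.
Proof.
move=> lj oU cU Ux Uy.
pose B : set X := [set z | U z /\ joined U x z].
suff BU : B = U by have : B y by [rewrite BU]; case.
apply: cU.
- by exists x; split => //; exact: joined_refl.
- exists B; last by apply/seteqP; split => [z [Uz Bz]|z [_]//]; split.
  rewrite openE => z [Uz xz]; have [r r0 rj] := lj U oU z Uz.
  apply/nbhs_ballP; exists r => // w; rewrite ballE => zw.
  have jzw := rj w zw; split; last exact: joined_trans jzw.
  by case: jzw => f [_ _ <-].
- exists (closure B); first exact: closed_closure.
  apply/seteqP; split => [z Bz|z [Uz clz]].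
    by case: (Bz) => Uz _; split => //; exact: subset_closure.
  split => //; have [r r0 rj] := lj U oU z Uz.
  have [w [[Uw xw]]] := clz _ (nbhsx_ballx z _ r0).
  rewrite ballE => zw; apply: joined_trans xw _; apply: joined_sym; exact: rj.
Qed.
End joining.

Section quasiconvex_joining.
Context {R : realType} {X : completeMetricType R}.
Variables (mu : borel_measure X R) (p : R).
Hypotheses (mu_balls : finite_positive_on_balls mu) (p1 : 1 <= p).
Hypotheses (mu_doubling : doubling mu) (X_poincare : poincare mu p).

Lemma poincare_locally_joined : @locally_joined R X.
Proof.
have [L L0 HL] := quasiconvex mu_balls p1 mu_doubling X_poincare.
move=> U oU x Ux; have /nbhs_ballP[r /= r0 rU] : nbhs x U by exact: open_nbhs_nbhs.
exists (r / L) => [|y xy]; first by rewrite divr_gt0.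
have [f [cf f0 f1 fL]] := HL x y; exists f; split => // t; apply: rU.
by rewrite ballE (le_lt_trans (fL t))// mulrC -ltr_pdivlMr.
Qed.
End quasiconvex_joining.
(** * Ends *)

Section ends_of_domains.
Context {R : realType} {X : completeMetricType R}.
Variable Omega : set X.
Hypothesis Omega_domain : bounded_domain Omega.
Hypothesis lj : @locally_joined R X.
Hypothesis proper_space :
  forall A : set X, closed A -> metric_bounded A -> compact A.
Implicit Types (A F : set X) (E : nat -> set X) (x y : X).

(** Otherwise the interior and the closure of [A] have the same trace on [F], which is then open and
    closed in [F]. *)
Lemma connected_meets_boundary F A : connected F -> F `&` A !=set0 ->
  F `\` A !=set0 -> F `&` boundary A !=set0.
Proof.
move=> cF FA [z [Fz nAz]]; apply: contrapT => nb.
suff FAF : F `&` A = F by apply: nAz; move: Fz; rewrite -FAF => -[].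
apply: cF => //.
- exists (interior A); first exact: open_interior.
  apply/seteqP; split => y [Fy Ay]; split => //; last exact: interior_subset.
  apply: contrapT => nAy; apply: nb; exists y; split => //; split => //.
  exact: subset_closure.
- exists (closure A); first exact: closed_closure.
  apply/seteqP; split => y [Fy Ay]; split => //; first exact: subset_closure.
  apply: contrapT => nAy; apply: nb; exists y; split => //; split => //.
  by move=> /interior_subset.
Qed.

(** If [F] left [E k], it would meet both boundaries inside one ball of radius [r], at points less
    than [2 * r] apart. *)
Lemma connected_sub_chain E k F x (r : R) : is_chain Omega E -> connected F ->
  F `<=` Omega -> F `<=` ball x r -> F `&` E k.+1 !=set0 ->
  ((2 * r)%:E <= set_dist (Omega `&` boundary (E k.+1)) (Omega `&` boundary (E k)))%E ->
  F `<=` E k.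
Proof.
move=> [_ nE _ _] cF FO Fr FE dr z Fz; apply: contrapT => nEz.
have [b [Fb bb]] : F `&` boundary (E k.+1) !=set0.
  by apply: connected_meets_boundary => //; exists z; split => // /nE.
have [a [Fa ba]] : F `&` boundary (E k) !=set0.
  apply: connected_meets_boundary => //; last by exists z.
  by case: FE => w [Fw /nE Ew]; exists w.
have : ((2 * r)%:E <= (mdist b a)%:E)%E.
  apply: le_trans dr _; apply: ereal_inf_lbound; exists (b, a) => //.
  by split; split => //; exact: FO.
rewrite lee_fin; clear dr; have := metric_triangle b x a.
have := Fr _ Fa; have := Fr _ Fb; rewrite !ballE (metric_sym b x).
by set p := mdist x b; set q := mdist x a => *; lra.
Qed.

Lemma acceptable_neq0 A : acceptable Omega A -> A !=set0.
Proof.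
move=> [_ _ _ [z [clz _]]]; have [y [Ay _]] := clz _ (nbhsx_ballx z 1 ltr01).
by exists y.
Qed.

Lemma nested_le E : (forall k, E k.+1 `<=` E k) ->
  forall m n, (m <= n)%N -> E n `<=` E m.
Proof.
move=> nE m n /subnK <-; elim: (n - m)%N => // k ih; rewrite addSn.
exact: subset_trans (nE _) ih.
Qed.

Lemma chain_impression_neq0 E : is_chain Omega E -> chain_impression E !=set0.
Proof.
move=> [aE nE _ _]; have /choice[z zE] : forall n, exists z, E n z.
  by move=> n; exact: (acceptable_neq0 (aE n)).
have c0 : compact (closure (E 0%N)).
  apply: proper_space; first exact: closed_closure.
  have [_ [x [r Er]] _ _] := aE 0%N; exists x, (r + 1) => y.
  move=> /metric_closureP /(_ 1 ltr01)[w /Er]; rewrite !ballE => xw yw.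
  have := metric_triangle x w y; rewrite (metric_sym w y).
  by move: xw yw; set p := mdist x w; set q := mdist y w => *; lra.
have zF n : (z @ \oo) (E n).
  by exists n => // m /= nm; apply: (nested_le nE nm); exact: zE.
have z0 : (z @ \oo) (closure (E 0%N)).
  by apply: filterS (zF 0%N); exact: subset_closure.
have [l [_ cl]] := c0 _ _ z0.
by exists l => n _ B lB; exact: cl.
Qed.

Lemma ends_eq E E' : chain_equiv E E' -> end_of Omega E = end_of Omega E'.
Proof.
move=> [EE' E'E]; apply/seteqP; split => G [cG [h1 h2]]; split => //; split.
- exact: divides_trans E'E h1.
- exact: divides_trans h2 EE'.
- exact: divides_trans EE' h1.
- exact: divides_trans h2 E'E.
Qed.

Lemma end_of_end E : is_chain Omega E -> is_end Omega (end_of Omega E).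
Proof. by move=> cE; exists E. Qed.

Lemma end_of_self E : is_chain Omega E -> end_of Omega E E.
Proof. by move=> cE; split => //; split => k; exists k. Qed.

(** Strictly decreasing radii keep the boundaries apart; the point [w] outside all balls makes each
    [F n] a proper subset of [Omega]; the point [x] in all closures gives acceptability and the
    impression. *)
Record ball_chain x (r : nat -> R) (F : nat -> set X) : Prop := BallChain {
  ball_chain_gt0 : forall n, 0 < r n ;
  ball_chain_lt : forall n, r n.+1 < r n ;
  ball_chain_cvg : forall e, 0 < e -> exists n, r n < e ;
  ball_chain_out : exists2 w, Omega w & forall n, ~ ball x (r n) w ;
  ball_chain_component : forall n, exists2 y, (ball x (r n) `&` Omega) y &
    F n = connected_component (ball x (r n) `&` Omega) y ;
  ball_chain_nested : forall n, F n.+1 `<=` F n ;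
  ball_chain_closure : forall n, closure (F n) x }.

Section one_ball_chain.
Variables (x : X) (r : nat -> R) (F : nat -> set X).
Hypotheses (bx : boundary Omega x) (bF : ball_chain x r F).

Lemma ball_chain_sub n : F n `<=` ball x (r n) `&` Omega.
Proof.
have [y _ ->] := ball_chain_component bF n; exact: connected_component_sub.
Qed.

Lemma ball_chain_connected n : connected (F n).
Proof. by have [y _ ->] := ball_chain_component bF n; exact: component_connected. Qed.

Lemma ball_chain_open n : open (F n).
Proof.
have [y _ ->] := ball_chain_component bF n; apply: component_open => //.
by apply: openI; [exact: open_ball|case: Omega_domain].
Qed.

Lemma ball_chain_closure_le n z : closure (F n) z -> mdist x z <= r n.
Proof.
move=> clz; apply/ler_addgt0Pr => e e0.
have [y Fy zy] := (metric_closureP _ _).1 clz e e0.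
have [+ _] := ball_chain_sub Fy; rewrite ballE => xy.
have := metric_triangle x y z; rewrite (metric_sym y z).
by move: xy zy; set p := mdist x y; set q := mdist z y => *; lra.
Qed.

(* A boundary point of the component F n inside Omega lies on the sphere of
   radius r n, because components of open sets are open. *)
Lemma ball_chain_boundary n z : (Omega `&` boundary (F n)) z -> mdist x z = r n.
Proof.
move=> [Oz [clz nz]]; apply/eqP; rewrite eq_le ball_chain_closure_le//=.
rewrite leNgt; apply/negP => zr; apply: nz.
have [y yB FE] := ball_chain_component bF n.
set B := ball x (r n) `&` Omega in yB FE.
have Bz : B z by split => //; rewrite ballE.
have oB : open B by apply: openI; [exact: open_ball|case: Omega_domain].
have oz := component_open z lj oB.
have nz : nbhs z (connected_component B z).
  by apply: open_nbhs_nbhs; split => //; exact: connected_component_refl.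
have [w [Fw zw]] := clz _ nz.
have -> : F n = connected_component B z.
  rewrite FE in Fw *; rewrite (same_connected_component Fw).
  by rewrite (same_connected_component zw).
by move: nz; rewrite /interior.
Qed.

Lemma ball_chain_impression : chain_impression F = [set x].
Proof.
apply/seteqP; split => [z zF|_ -> n _]; last exact: (ball_chain_closure bF).
apply/esym/mdist_positivity/eqP; rewrite eq_le mdist_ge0 andbT.
apply/ler_addgt0Pr => e e0; rewrite add0r.
have [n ne] := ball_chain_cvg bF e0.
exact: le_trans (ball_chain_closure_le (zF n I)) (ltW ne).
Qed.

(** Inside [Omega] the boundaries lie on spheres around [x] of radii [r n.+1 < r n], so their
    distance is at least the difference of the radii. *)
Lemma ball_chain_chain : is_chain Omega F.
Proof.
split.
- move=> n; split.
  + have [w Ow nw] := ball_chain_out bF; split.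
      by move=> z /ball_chain_sub[].
    by move=> /(_ _ Ow)/ball_chain_sub[/nw].
  + by exists x, (r n) => z /ball_chain_sub[].
  + exact: ball_chain_connected.
  + by exists x; split => //; exact: (ball_chain_closure bF).
- exact: (ball_chain_nested bF).
- move=> n; apply: (@lt_le_trans _ _ (r n - r n.+1)%:E).
    by rewrite lte_fin subr_gt0; exact: (ball_chain_lt bF).
  apply: le_ereal_inf_tmp =>
    _ [[a b] /= [/ball_chain_boundary a1 /ball_chain_boundary b1] <-].
  by rewrite lee_fin; have := metric_triangle x a b; rewrite a1 b1 => *; lra.
- by rewrite ball_chain_impression => _ ->.
Qed.

(** Once [r n] is below half the distance between the boundaries of [E k] and [E k.+1], the set
    [F n], which meets [E k.+1], is too small to leave [E k]. *)
Lemma ball_chain_divides E : is_chain Omega E ->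
  (forall n k, F n `&` E k !=set0) -> divides F E.
Proof.
move=> cE FE k.
have [d d0 dE] : exists2 d : R, 0 < d & (d%:E <=
    set_dist (Omega `&` boundary (E k.+1)) (Omega `&` boundary (E k)))%E.
  have [_ _ /(_ k) + _] := cE; case: (set_dist _ _) => [d d0||//].
    by exists d.
  (* When the distance is infinite, any positive [d] serves. *)
  by exists 1 => //; rewrite leey.
have d20 : 0 < d / 2 by rewrite divr_gt0.
have [n nd] := ball_chain_cvg bF d20; exists n.
apply: (@connected_sub_chain _ _ _ x (r n)) => //.
- exact: ball_chain_connected.
- by move=> z /ball_chain_sub[].
- by move=> z /ball_chain_sub[].
- by apply: le_trans dE; rewrite lee_fin; lra.
Qed.

(** A chain [G] dividing [F] has a member inside each [F n]; by nestedness every [F n] then meets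
    every [G k], so [F] divides [G] in turn. *)
Lemma ball_chain_prime : is_prime_end Omega (end_of Omega F).
Proof.
have cF := ball_chain_chain; split; first exact: end_of_end.
move=> _ [G cG ->] GF.
have /(end_dividesP (end_of_end cG) (end_of_end cF) (end_of_self cG) (end_of_self cF))
  {}GF := GF.
apply: ends_eq; split => //.
apply: ball_chain_divides => // n k.
have [m Gm] := GF n; have [aG nG _ _] := cG.
have [z Gz] := acceptable_neq0 (aG (maxn m k)).
exists z; split; last by apply: (nested_le nG _ Gz); exact: leq_maxr.
by apply: Gm; apply: (nested_le nG _ Gz); exact: leq_maxl.
Qed.

End one_ball_chain.

(** * Selection of nested components by pigeonhole *)

Section construction.
Variable x : X.
Hypotheses (bx : boundary Omega x) (fcx : finitely_connected_at Omega x).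
Variable E : nat -> set X.
Hypotheses (EO : forall k, E k `<=` Omega) (nE : forall k, E k.+1 `<=` E k).

(** The invariant of the recursion: [A] meets the sets of the sequence arbitrarily close to [x].
    Merely meeting them would not survive the passage to a smaller ball. *)
Let near_all A := forall k, closure (A `&` E k) x.

(** The pigeonhole in contrapositive form: finitely many indices and distances have a maximum and a
    positive minimum. *)
Let uniform_far (s : seq (set X)) A :
  (forall C, C \in s -> exists k, exists2 e : R, 0 < e &
     forall z, (C `&` (A `&` E k)) z -> e <= mdist x z) ->
  exists k, exists2 e : R, 0 < e &
     forall C z, C \in s -> (C `&` (A `&` E k)) z -> e <= mdist x z.
Proof.
elim: s => [|C s ih] h; first by exists 0%N, 1.
have [|k [e e0 H]] := ih; first by move=> D Ds; apply: h; rewrite inE Ds orbT.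
have [k' [e' e'0 H']] := h C (mem_head _ _).
exists (maxn k k'), (Num.min e e'); first by rewrite lt_min e0.
move=> D z; rewrite inE ge_min => /predU1P[->|Ds] [Dz [Az Ez]].
  apply/orP; right; apply: H'; split => //; split => //.
  by apply: (nested_le nE _ Ez); exact: leq_maxr.
apply/orP; left; apply: (H D) => //; split => //; split => //.
by apply: (nested_le nE _ Ez); exact: leq_maxl.
Qed.

(** One of the finitely many components of [G] in [Omega] inherits the invariant; it lies in a
    component for [ball x r], which inherits it in turn. *)
Lemma near_component (r : R) A : 0 < r -> near_all A ->
  exists y, [/\ A y, (ball x r `&` Omega) y &
    near_all (connected_component (ball x r `&` Omega) y)].
Proof.
move=> r0 nA; have [G [oG Gx Gr /finite_seqP[s sE]]] := fcx r0.
have /nbhs_ballP[rho /= rho0 rhoG] : nbhs x G by exact: open_nbhs_nbhs.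
have [C Cs HC] : exists2 C, C \in s & forall k (e : R), 0 < e ->
    exists2 z, (C `&` (A `&` E k)) z & mdist x z < e.
  apply: contrapT => nC.
  have [C Cs|k [e e0 H]] := @uniform_far s A.
    apply: contrapT => h; apply: nC; exists C => // k e e0.
    apply: contrapT => h'; apply: h; exists k, e => // z Cz.
    by rewrite leNgt; apply/negP => xz; apply: h'; exists z.
  (* Below [rho] the points of [Omega] lie in [G], hence in a listed component; below [e] they
     violate the common distance. *)
  have m0 : 0 < Num.min e rho by rewrite lt_min e0.
  have [z AEz] := (metric_closureP _ _).1 (nA k) _ m0.
  rewrite lt_min => /andP[xze xzr].
  have GOz : (G `&` Omega) z.
    by split; [apply: rhoG; rewrite ballE|apply: (EO (k := k)); case: AEz].
  suff : e <= mdist x z by rewrite leNgt xze.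
  apply: (H (connected_component (G `&` Omega) z)); last first.
    by split => //; exact: connected_component_refl.
  have : [set` s] (connected_component (G `&` Omega) z) by rewrite -sE; exists z.
  by [].
have : [set` s] C by [].
rewrite -sE => -[w GOw CE].
have [y [Cy [Ay Ey]] _] := HC 0%N 1 ltr01.
have CrO : C `<=` ball x r `&` Omega.
  by rewrite -CE => z /connected_component_sub[/Gr].
exists y; split => //; first exact: CrO.
move=> k; apply/metric_closureP => e e0.
have [z [Cz [Az Ez]] xz] := HC k e e0; exists z => //; split => //.
have : connected_component (ball x r `&` Omega) y z.
  apply: (connected_component_max Cy CrO) => //.
  by rewrite -CE; exact: component_connected.
by [].
Qed.

Lemma exists_ball_chain : (forall k, closure (E k) x) ->
  exists r (F : nat -> set X), ball_chain x r F /\ forall n k, F n `&` E k !=set0.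
Proof.
move=> clE.
have [oO [w Ow] _ _] := Omega_domain.
have xw : 0 < mdist x w.
  rewrite mdist_gt0; apply/eqP => xw; case: bx => _; apply.
  by rewrite xw; apply: open_nbhs_nbhs.
(* No radius exceeds the distance from [x] to [w], so the point [w] of [Omega] stays outside every
   ball. *)
pose r n : R := mdist x w / n.+1%:R.
have r0 n : 0 < r n by rewrite divr_gt0.
pose B n := ball x (r n) `&` Omega.
have rlt n : r n.+1 < r n by rewrite ltr_pM2l// ltf_pV2 ?posrE// ltr_nat.
pose Q n A := near_all A /\ exists2 y, B n y & A = connected_component (B n) y.
(* The selection is a total function of the index and the previous set, so that [F] can be defined
   by recursion; [set0] is the default for sets violating the invariant. *)
have /choice[g gP] : forall nA : nat * set X, exists A', near_all nA.2 ->
    Q nA.1 A' /\ nA.2 `&` A' !=set0.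
  move=> [n A]; have [nA|nA] := pselect (near_all A); last by exists set0.
  have [y [Ay By ny]] := near_component (r0 n) nA.
  exists (connected_component (B n) y) => _; split; first by split => //; exists y.
  by exists y; split => //; exact: connected_component_refl.
pose F := fix F n := if n is m.+1 then g (n, F m) else g (0%N, Omega).
have nO : near_all Omega by move=> k; rewrite (setIidr (EO (k := k))); exact: clE.
have QF n : Q n (F n).
  elim: n => [|n [ih _]]; first by have [] := gP (0%N, Omega) nO.
  by have [] := gP (n.+1, F n) ih.
exists r, F; split; last first.
  move=> n k; have [nF _] := QF n; have [z [FEz _]] := nF k _ (nbhsx_ballx x 1 ltr01).
  by exists z.
split => //.
- move=> e e0; exists (Num.truncn (mdist x w / e)).
  by rewrite /r ltr_pdivrMr// mulrC -ltr_pdivrMr// truncnS_gt.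
- exists w => // n; rewrite ballE; apply/negP; rewrite -leNgt /r.
  by rewrite ler_pdivrMr// ler_peMr ?(ltW xw)// ler1n.
- by move=> n; have [_] := QF n.
(* The new component is connected, lies in the larger ball and shares [z] with [F n], hence is
   contained in it. *)
- move=> n; have [nF [y By FE]] := QF n; have [_ [y' By' FE']] := QF n.+1.
  have [_ [z [Fz gz]]] := gP (n.+1, F n) nF.
  have Fz' : F n.+1 z by [].
  rewrite FE' in Fz' *; rewrite (same_connected_component Fz').
  rewrite FE in Fz *; rewrite (same_connected_component Fz).
  apply: connected_component_max.
  + by apply: connected_component_refl; exact: connected_component_sub Fz'.
  + move=> v /connected_component_sub[]; rewrite ballE => xv Ov; split => //.
    by rewrite ballE (lt_trans xv).
  + exact: component_connected.
- move=> n; have [nF _] := QF n.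
  by apply: (closureS _ (nF 0%N)); exact: subIsetl.
Qed.

End construction.


Lemma ball_chain_dividing E x : finitely_connected_at_boundary Omega ->
  is_chain Omega E -> chain_impression E x -> boundary Omega x ->
  exists r (F : nat -> set X), ball_chain x r F /\ divides F E.
Proof.
move=> fc cE Ex bx; have [aE nE _ _] := cE.
have EO k : E k `<=` Omega by have [[]] := aE k.
have [r [F [bF FE]]] := exists_ball_chain bx (fc _ bx) EO nE (fun k => Ex k I).
by exists r, F; split => //; exact: (ball_chain_divides bF cE FE).
Qed.

(* The witness g n agrees with f n (. - n) beyond n and restricts to g m on
   ]-oo, m + 1], so s |-> g (truncn s) s is locally one of the g n. *)
Lemma concatenation (f : nat -> R -> X) : (forall n, continuous (f n)) ->
  (forall n, f n 1 = f n.+1 0) ->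
  exists h : R -> X, continuous h /\
    forall s, 0 <= s -> h s = f (Num.truncn s) (s - (Num.truncn s)%:R).
Proof.
move=> cf ff.
pose g := fix g n (s : R) : X := if n is m.+1 then
  (if s <= n%:R then g m s else f n (s - n%:R)) else f 0%N s.
have gf n (s : R) : n%:R <= s -> g n s = f n (s - n%:R).
  elim: n s => [|n ih] s ns; first by rewrite subr0.
  rewrite /g -/g; case: leP => // sn.
  have -> : s = n.+1%:R by apply/eqP; rewrite eq_le ns sn.
  rewrite ih ?ler_nat// subrr -ff; congr (f n _).
  by rewrite -natrB// subSnn.
have cg n : continuous (g n).
  elim: n => [|n ih]; first exact: cf.
  rewrite (_ : g n.+1 = fun s => if s <= n.+1%:R then g n s else f n.+1 (s - n.+1%:R))//.
  apply: continuous_glue => //.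
    move=> t; apply: continuous_comp; last exact: cf.
    by apply: (@continuousB _ R^o); [exact: cvg_id|exact: cvg_cst].
  rewrite subrr -ff gf ?ler_nat//; congr (f n _).
  by rewrite -natrB// subSnn.
have gle m n (s : R) : (m <= n)%N -> s <= m.+1%:R -> g n s = g m s.
  move=> /subnK <-; elim: (n - m)%N => [|k ih] // sm.
  rewrite addSn /g -/g ifT ?ih// (le_trans sm)// ler_nat ltnS leq_addl //.
exists (fun s => g (Num.truncn s) s); split; last first.
  by move=> s s0; rewrite gf// -truncn_ge_nat.
move=> s.
have near_g : \forall t \near s, g (Num.truncn s) t = g (Num.truncn t) t.
  have ts : \forall t \near s, t < (Num.truncn s).+1%:R.
    by apply: lt_nbhsl; exact: truncnS_gt.
  near=> t; have tS : t < (Num.truncn s).+1%:R by near: t.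
  apply: gle; last by rewrite ltW// truncnS_gt.
  by rewrite truncn_le_nat.
have := cg (Num.truncn s) s; apply: cvg_trans.
by apply: near_eq_cvg.
Unshelve. all: by end_near. Qed.

(** For the time change [s / (1 - s)] from [[0, 1[] to the half-line, the time [n] corresponds to
    [1 - 1 / (n + 1)]. *)
Lemma nat_le_odds (n : nat) (s : R) : s < 1 -> 1 - n.+1%:R^-1 < s ->
  n%:R <= s / (1 - s).
Proof.
move=> s1 ns; have s10 : 0 < 1 - s by rewrite subr_gt0.
rewrite ler_pdivlMr//.
have h : 1 - s <= n.+1%:R^-1 by rewrite lerBlDl -lerBlDr ltW.
have : n.+1%:R * (1 - s) <= 1 by rewrite mulrC -ler_pdivlMr// div1r.
by rewrite -natr1 mulrDl mul1r => ?; lra.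
Qed.

Lemma ball_chain_accessible x r (F : nat -> set X) : boundary Omega x ->
  ball_chain x r F ->
  accessible Omega x.
Proof.
move=> bx bF; have cF := ball_chain_chain bx bF.
have /choice[z zF] : forall n, exists z, F n z.
  by have [aF _ _ _] := cF; move=> n; exact: (acceptable_neq0 (aF n)).
have /choice[f fP] : forall n, exists f : R -> X,
    [/\ continuous f, f 0 = z n, f 1 = z n.+1 & forall t, F n (f t)].
  move=> n; apply: (connected_open_joined lj).
  - exact: (ball_chain_open bF).
  - exact: (ball_chain_connected bF).
  - exact: zF.
  - by apply: (ball_chain_nested bF); exact: zF.
have [|n|h [ch hE]] := @concatenation f.
- by move=> n; have [] := fP n.
- by have [_ _ -> _] := fP n; have [_ -> _ _] := fP n.+1.
have hF s : 0 <= s -> F (Num.truncn s) (h s).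
  by move=> s0; rewrite hE//; have [_ _ _] := fP (Num.truncn s); exact.
exists (fun t => if t < 1 then h (t / (1 - t)) else x); split.
- apply: continuous_in_subspaceT => t; rewrite inE/= in_itv/= => /andP[t0].
  rewrite le_eqVlt => /predU1P[->|t1].
    (* Continuity at 1: from time [n] on the curve stays in [F n], hence within [r n] of [x]. *)
    apply/(@metricType_numDomainType.cvgrPdist_lt _ X) => e e0; rewrite ltxx.
    have [n ne] := ball_chain_cvg bF e0.
    have near1 : \forall s \near (1 : R), 1 - n.+1%:R^-1 < s.
      by apply: lt_nbhsr; rewrite ltrBlDr ltrDl invr_gt0.
    have near0 : \forall s \near (1 : R), 0 < s by exact: lt_nbhsr.
    near=> s; case: ifPn => s1; last by rewrite mdistxx.
    have s1' : 1 - n.+1%:R^-1 < s by near: s.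
    have s0 : 0 < s by near: s.
    have q0 : 0 <= s / (1 - s) by rewrite divr_ge0 ?ltW// subr_gt0.
    have nq : (n <= Num.truncn (s / (1 - s)))%N.
      by rewrite truncn_ge_nat//; exact: nat_le_odds.
    apply: le_lt_trans ne; apply: (ball_chain_closure_le bF).
    apply: subset_closure; apply: (nested_le (ball_chain_nested bF) nq).
    exact: hF.
  have near1 : \forall s \near t, s < 1 by exact: lt_nbhsl.
  rewrite /continuous_at t1.
  have : (h \o (fun s => s / (1 - s))) @ t --> (h \o (fun s => s / (1 - s))) t.
    apply: continuous_comp; last exact: ch.
    apply: (@continuousM R R^o); first exact: cvg_id.
    apply: (@continuousV R R^o); first by rewrite subr_eq0 gt_eqF.
    by apply: (@continuousB _ R^o); [exact: cvg_cst|exact: cvg_id].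
  apply: cvg_trans; apply: near_eq_cvg.
  by near=> s; rewrite ifT//; near: s.
- by rewrite ltxx.
- move=> t /andP[t0 t1]; rewrite t1.
  have q0 : 0 <= t / (1 - t) by rewrite divr_ge0// subr_ge0 ltW.
  by have [] := ball_chain_sub bF (hF _ q0).
Unshelve. all: by end_near. Qed.

(** * Prime ends of finitely connected domains *)

Section finitely_connected.
Hypothesis fc : finitely_connected_at_boundary Omega.

Lemma end_divided_by_ball_chain e : is_end Omega e ->
  exists x r (F : nat -> set X), [/\ boundary Omega x, ball_chain x r F &
    end_divides (end_of Omega F) e].
Proof.
move=> [E cE ->]; have [x Ex] := chain_impression_neq0 cE.
have bx : boundary Omega x by have [_ _ _] := cE; exact.
have [r [F [bF FE]]] := ball_chain_dividing fc cE Ex bx.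
have cF := ball_chain_chain bx bF.
exists x, r, F; split => //; exists F, E; split => //; exact: end_of_self.
Qed.

(** The construction is fed with the constant sequence [Omega], which accumulates at every boundary
    point although it is not a chain. *)
Lemma boundary_ball_chain x : boundary Omega x ->
  exists r (F : nat -> set X), ball_chain x r F.
Proof.
move=> bx; have clO (k : nat) : closure Omega x by case: bx.
have [r [F [bF _]]] := exists_ball_chain bx (fc bx) (E := fun=> Omega)
  (fun=> @subset_refl _ Omega) (fun=> @subset_refl _ Omega) clO.
by exists r, F.
Qed.

Lemma ball_chain_end_impression x r (F : nat -> set X) : boundary Omega x ->
  ball_chain x r F ->
  impression (end_of Omega F) = [set x].
Proof.
move=> bx bF; have cF := ball_chain_chain bx bF.
rewrite (impression_end (end_of_end cF) (end_of_self cF)).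
exact: (ball_chain_impression bF).
Qed.

Lemma prime_end_ball_chain e : is_prime_end Omega e ->
  exists x r (F : nat -> set X),
    [/\ boundary Omega x, ball_chain x r F & e = end_of Omega F].
Proof.
move=> [ee ep]; have [x [r [F [bx bF Fe]]]] := end_divided_by_ball_chain ee.
exists x, r, F; split => //; apply/esym/ep => //.
by apply: end_of_end; exact: (ball_chain_chain bx bF).
Qed.

(** Ends of ball chains are prime, are [Mod_p]-ends by assumption, and one of them divides any given
    end. So a prime end of either kind equals the one dividing it; and primeness among all ends
    implies primeness among [Mod_p]-ends. *)
Lemma prime_end_boundary_Mod (mu : borel_measure X R) (p : R) :
  (forall x r (F : nat -> set X), boundary Omega x -> ball_chain x r F ->
    is_Mod_chain Omega mu p F) ->
  prime_end_boundary Omega = Mod_prime_end_boundary Omega mu p.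
Proof.
move=> HM.
have ME x r (F : nat -> set X) : boundary Omega x -> ball_chain x r F ->
  is_Mod_end Omega mu p (end_of Omega F).
  move=> bx bF; have cF := ball_chain_chain bx bF; split; first exact: end_of_end.
  by exists F; [exact: end_of_self|exact: (HM _ _ _ bx bF)].
apply/seteqP; split => e /=.
  move=> pe; have [x [r [F [bx bF eF]]]] := prime_end_ball_chain pe.
  split; first by rewrite eF; exact: (ME _ _ _ bx bF).
  by move=> f [ef _] fe; have [_] := pe; exact.
move=> [[ee _] ep]; have [x [r [F [bx bF Fe]]]] := end_divided_by_ball_chain ee.
rewrite -(ep _ (ME _ _ _ bx bF) Fe); exact: (ball_chain_prime bx bF).
Qed.
End finitely_connected.

End ends_of_domains.
(** * Modulus *)

Section modulus_of_annuli.
Context {R : realType} {X : completeMetricType R}.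
Variables (mu : borel_measure X R) (p : R).
Hypotheses (mu_balls : finite_positive_on_balls mu) (p1 : 1 <= p).
Local Notation leb := (@lebesgue_measure R).

(** Take the first time [b] at distance at least [v] and the last earlier time [sup S] at distance
    at most [u]. The distance to [x] is 1-Lipschitz along the curve, so the passage takes at least
    [v - u]. *)
Lemma curve_crossing (c : rect_curve X) (x : X) (u v : R) : u < v ->
  mdist x (c 0) < u -> v <= mdist x (c (len c)) ->
  exists a b : R, [/\ 0 <= a, b <= len c, v - u <= b - a &
    forall t : R, a < t < b -> u <= mdist x (clamp_curve c t) < v].
Proof.
move=> uv c0 cl; have l0 := ltW (len_gt0 c).
pose h t := mdist x (clamp_curve c t).
have hlip s t : s <= t -> h t - h s <= t - s.
  move=> st; have := dist_clamp_curve_le c s t; rewrite ger0_norm ?subr_ge0// => hd.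
  apply: le_trans hd; rewrite lerBlDr addrC; exact: metric_triangle.
have h0 : h 0 < u by rewrite /h clamp_curveE// lexx.
have hl : v <= h (len c) by rewrite /h clamp_curveE// lexx l0.
pose T := [set t | 0 <= t <= len c /\ v <= h t].
have Tl : T (len c) by split => //; rewrite l0 lexx.
have T0 : T !=set0 by exists (len c).
have Tlb : has_lbound T by exists 0 => t [/andP[]].
pose b := inf T.
have b0 : 0 <= b by apply: lb_le_inf => // t [/andP[]].
have bl : b <= len c by exact: ge_inf.
pose S := [set t | 0 <= t <= b /\ h t <= u].
have S0 : S 0 by split; [rewrite lexx|exact: ltW].
have Sne : S !=set0 by exists 0.
have Sub : has_ubound S by exists b => t [/andP[]].
exists (sup S), b; split => //.
- exact: ub_le_sup.
- have : sup S <= b - (v - u).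
    apply: ge_sup => // s [/andP[s0 sb] hs].
    rewrite lerBrDr; apply: lb_le_inf => // t Tt; have [/andP[t0 tl] ht] := Tt.
    have st : s <= t by apply: le_trans sb _; exact: ge_inf.
    by have := hlip _ _ st; lra.
  by lra.
- move=> t /andP[at_ tb].
  have t0 : 0 <= t by apply: le_trans (ltW at_); exact: ub_le_sup.
  apply/andP; split.
    rewrite leNgt; apply/negP => htu.
    have : t <= sup S by apply: ub_le_sup => //; split; [rewrite t0 ltW|exact: ltW].
    by rewrite leNgt at_.
  rewrite ltNge; apply/negP => hvt.
  have : b <= t by apply: ge_inf => //; split => //; rewrite t0 (le_trans (ltW tb)).
  by rewrite leNgt tb.
Qed.

Section annuli.
Variables (x : X) (S : R) (n : nat).
Hypotheses (S0 : 0 < S) (n0 : (0 < n)%N).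
Let rad i : R := S / 2 ^+ i.
Let A (i : nat) : set X := ball x (rad i) `\` ball x (rad i.+1).
(** The annulus [A i] has thickness [rad i.+1], so crossing it contributes at least [1 / n] to the
    line integral of [rho], and [n] crossings give 1. *)
Let c i : R := (n%:R * rad i.+1)^-1.
Let rho (y : X) : \bar R := (\sum_(i < n) c i * \1_(A i) y)%:E.

Let rad_gt0 i : 0 < rad i. Proof. by rewrite divr_gt0// exprn_gt0. Qed.

Let radS i : rad i = 2 * rad i.+1.
Proof. by rewrite /rad exprS invfM mulrCA mulVKf. Qed.

Let rad_le i j : (i <= j)%N -> rad j <= rad i.
Proof.
by move=> ij; rewrite ler_pM2l// lef_pV2 ?posrE ?exprn_gt0// ler_eXn2l// ltr1n.
Qed.

Let c_gt0 i : 0 < c i.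
Proof. by rewrite invr_gt0 mulr_gt0// ltr0n. Qed.

Let A_disjoint i j y : A i y -> A j y -> i = j.
Proof.
wlog ij : i j / (i <= j)%N => [H Ai Aj|].
  by have [/H|/ltnW/H h] := leqP i j; [exact|apply/esym/h].
move=> [_ Ai] [Aj _]; apply/eqP; rewrite eqn_leq ij/= leqNgt; apply/negP => lij.
apply: Ai; move: Aj; rewrite !ballE => /lt_le_trans; apply; exact: rad_le.
Qed.

Let measurable_A i : measurable (A i : set (borel X)).
Proof. by apply: measurableD; exact: borel_ball. Qed.

Let rho_borel : nonneg_borel rho.
Proof.
split=> [|y]; last first.
  by rewrite lee_fin sumr_ge0// => i _; rewrite mulr_ge0// ltW.
apply/measurable_EFinP; apply: measurable_sum => i.
apply: measurable_funM; first exact: measurable_cst.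
exact: measurable_indic.
Qed.

(** The annuli are disjoint, so at most one term is nonzero at [y] and the power passes through the
    sum. *)
Let rho_pow y : (rho y `^ p = \sum_(i < n) ((c i `^ p) * \1_(A i) y)%:E)%E.
Proof.
have p0 : p != 0 by rewrite gt_eqF// (lt_le_trans _ p1).
rewrite /rho poweR_EFin sumEFin; congr EFin.
have [[j Aj]|nA] := pselect (exists j : 'I_n, A j y); last first.
  rewrite !big1 ?powR0// => i _; rewrite indicE memNset ?mulr0// => Ai; apply: nA;
    by exists i.
have z (i : 'I_n) : i != j -> \1_(A i) y = 0 :> R.
  move=> ij; rewrite indicE memNset// => Ai; move/eqP: ij; apply; apply: val_inj.
  exact: A_disjoint Ai Aj.
rewrite (bigD1 j)//= [in RHS](bigD1 j)//= !big1.
- by rewrite !addr0 indicE mem_set// !mulr1.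
- by move=> i ij; rewrite z// mulr0.
- by move=> i ij; rewrite z// mulr0.
Qed.

Let rho_admissible (g : rect_curve X) : mdist x (g 0) < rad n ->
  S <= mdist x (g (len g)) -> (1 <= line_integral g rho)%E.
Proof.
move=> g0 gl.
have mf (i : nat) : measurable_fun `[0, len g]
  (fun t => (c i * \1_(A i) (clamp_curve g t))%:E).
  apply: measurable_funTS.
  apply: (measurable_clamp_curve g (rho := fun y => (c i * \1_(A i) y)%:E)).
  apply/measurable_EFinP; apply: measurable_funM; first exact: measurable_cst.
  exact: measurable_indic.
have f0 (i : nat) t : (0 <= (c i * \1_(A i) (clamp_curve g t))%:E)%E.
  by rewrite lee_fin mulr_ge0// ltW.
have part (i : 'I_n) : ((n%:R^-1)%:E <=
    \int[leb]_(t in `[0%R, len g]) (c i * \1_(A i) (clamp_curve g t))%:E)%E.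
  have rlt : rad i.+1 < rad i by rewrite (radS i) ltr_pMl// ltr1n.
  have g0' : mdist x (g 0) < rad i.+1 by apply: lt_le_trans g0 _; exact: rad_le.
  have gl' : rad i <= mdist x (g (len g)).
    by apply: le_trans gl; rewrite -[S]divr1 -(expr0 2); exact: rad_le.
  have [a [b [a0 bl ab H]]] := curve_crossing rlt g0' gl'.
  have ab0 : a < b.
    by rewrite -subr_gt0 (lt_le_trans _ ab)// subr_gt0.
  apply: (@le_trans _ _
    (\int[leb]_(t in `]a, b[) (c i * \1_(A i) (clamp_curve g t))%:E)%E).
    rewrite (_ : (\int[leb]_(t in `]a, b[) _ = \int[leb]_(t in `]a, b[) (c i)%:E)%E);
      last first.
      apply: eq_integral => t; rewrite inE/= in_itv/= => /H/andP[h1 h2].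
      rewrite indicE mem_set ?mulr1//; split; rewrite ballE//.
      by apply/negP; rewrite -leNgt.
    rewrite integral_cst// [X in (_ <= _ * X)%E]lebesgue_measure_itv/= lte_fin ab0
      -EFinD -EFinM lee_fin.
    rewrite /c invfM -mulrA ler_peMr ?invr_ge0// ler_pdivlMl// mulr1.
    by apply: le_trans ab; rewrite (radS i) mulr_natl mulr2n addrK.
  apply: ge0_subset_integral => //; first exact: mf.
  move=> t /=; rewrite !in_itv/= => /andP[at_ tb].
  by rewrite (le_trans a0 (ltW at_)) (le_trans (ltW tb) bl).
rewrite line_integral_clamp /rho.
under eq_integral => t _ do rewrite -sumEFin.
rewrite ge0_integral_sum//; last by move=> i; exact: mf.
apply: (@le_trans _ _ (\sum_(i < n) (n%:R^-1)%:E)%E); last by apply: lee_sum => i _;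
  exact: part.
have n1 : \sum_(i < n) (n%:R^-1 : R) = 1.
  by rewrite sumr_const card_ord -[LHS]mulr_natr mulVf// pnatr_eq0 -lt0n.
by rewrite [leRHS](sumEFin (index_enum 'I_n) xpredT (fun=> n%:R^-1)) n1.
Qed.

Lemma modulus_annuli (G : set (rect_curve X)) :
  (forall g, G g -> mdist x (g 0) < S / 2 ^+ n /\ S <= mdist x (g (len g))) ->
  (modulus mu p G <= (\sum_(i < n) (n%:R * (S / 2 ^+ i.+1))^-1 `^ p *
      fine (mu (ball x (S / 2 ^+ i))))%:E)%E.
Proof.
move=> HG; apply: (@le_trans _ _ (\int[mu]_y (rho y `^ p))%E).
  apply: ereal_inf_lbound; exists rho => //; split; first exact: rho_borel.
  by move=> g /HG[h1 h2]; exact: rho_admissible.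
under eq_integral => y _ do rewrite rho_pow.
rewrite ge0_integral_sum//; last 2 first.
- move=> i; apply/measurable_EFinP; apply: measurable_funM; first exact: measurable_cst.
  exact: measurable_indic.
- by move=> i y _; rewrite lee_fin mulr_ge0// powR_ge0.
rewrite -sumEFin; apply: lee_sum => i _.
under eq_integral => y _ do rewrite EFinM.
rewrite ge0_integralZl//; last 2 first.
- by apply/measurable_EFinP; exact: measurable_indic.
- by rewrite lee_fin powR_ge0.
rewrite integral_indic// setIT EFinM lee_wpmul2l ?lee_fin ?powR_ge0//.
rewrite -(ball_measure_fin mu_balls x (rad_gt0 i)).
by apply: le_measure; rewrite ?inE//; [exact: borel_ball|move=> y []].
Qed.

End annuli.

(** For [p > 1] take [q = p]. If [p = 1] and no exponent exceeds 1, the dimension set is (0, 1],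
    because it contains every positive number below a member. *)
Lemma dimension_set_gt1 x : dimension_set mu x p ->
  dimension_set mu x <> `]0, 1]%classic ->
  exists q, [/\ dimension_set mu x q, p <= q & 1 < q].
Proof.
move=> Qp Qn; have [p1'|] := ltP 1 p; first by exists p.
move=> ple1; have pE : p = 1 by apply/eqP; rewrite eq_le ple1 p1.
apply: contrapT => nq; apply: Qn; apply/seteqP; split => q /=; rewrite in_itv/=.
  move=> Qq; have [-> _] := Qq; rewrite /= leNgt; apply/negP => q1.
  by apply: nq; exists q; split => //; rewrite pE ltW.
move=> /andP[q0 q1]; split => //.
have [_ [C [r0 [C0 r00 H]]]] := Qp; exists C, r0; split => // r s rp rs sr.
apply: le_trans (H _ _ rp rs sr) _; rewrite ler_pM2l// pE.
have s0 : 0 < s by exact: lt_le_trans rs.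
apply: ger_powR => //.
by rewrite divr_gt0//= ler_pdivrMr// mul1r.
Qed.

(** For [p < q] the geometric series converges and [n^(-p) <= 1 / n]; for [p = q] the sum equals
    [n], and [n^(1-p)] tends to 0 because then [p > 1]. *)
Lemma sum_geometric_small (q e : R) : p <= q -> 1 < q -> 0 < e ->
  exists2 n, (0 < n)%N & n%:R `^ (- p) * \sum_(i < n) (2 `^ (p - q)) ^+ i < e.
Proof.
move=> pq q1 e0; pose a : R := 2 `^ (p - q).
have a0 : 0 < a by exact: powR_gt0.
have [pq'|] := ltP p q.
  have a1 : a < 1.
    rewrite /a -(opprB q p) powRN invf_lt1 ?powR_gt0//.
    have h1 : (1 : R) `^ (q - p) = 1 by rewrite powR1.
    rewrite -[ltLHS]h1; apply: gt0_ltr_powR; rewrite ?subr_gt0 ?nnegrE ?ltr1n//.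
  have ia0 : 0 < (1 - a)^-1 by rewrite invr_gt0 subr_gt0.
  pose n := (Num.truncn ((1 - a)^-1 / e)).+1; exists n => //.
  have n0 : 0 < n%:R :> R by rewrite ltr0n.
  have S1 : \sum_(i < n) a ^+ i <= (1 - a)^-1.
    rewrite -[leRHS]mul1r ler_pdivlMr ?subr_gt0// mulrC -[1 - a]opprB mulNr -subrX1.
    by rewrite opprB gerBl exprn_ge0// ltW.
  have n1 : n%:R `^ (- p) <= n%:R^-1.
    rewrite -powR_inv1 ?(ltW n0)//; apply: ler_powR; first by rewrite ler1n.
    by rewrite lerN2.
  apply: (@le_lt_trans _ _ (n%:R^-1 * (1 - a)^-1)).
    by rewrite ler_pM ?powR_ge0// sumr_ge0// => i _; rewrite exprn_ge0// ltW.
  by rewrite ltr_pdivrMl// mulrC -ltr_pdivrMl// mulrC truncnS_gt.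
move=> qp; have qE : q = p by apply/eqP; rewrite eq_le pq qp.
rewrite qE in q1 *; have p10 : 0 < p - 1 by rewrite subr_gt0.
(* [w] solves [w^(p-1) = 1 / e], so any [n > w] will do. *)
pose w : R := e^-1 `^ (p - 1)^-1.
pose n := (Num.truncn w).+1; exists n => //.
have n0 : 0 < n%:R :> R by rewrite ltr0n.
rewrite subrr powRr0; under eq_bigr do rewrite expr1n.
rewrite sumr_const card_ord -{2}(powRr1 (ltW n0)) -powRD; last first.
  by apply/implyP => _; rewrite pnatr_eq0.
rewrite (_ : - p + 1 = - (p - 1)); last by ring.
rewrite powRN -[e]invrK ltf_pV2 ?posrE ?powR_gt0// ?invr_gt0//.
have -> : e^-1 = w `^ (p - 1) by rewrite -powRrM mulVf ?gt_eqF// powRr1// invr_ge0 ltW.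
by apply: gt0_ltr_powR; rewrite ?nnegrE ?powR_ge0 ?(ltW n0)// truncnS_gt.
Qed.

Lemma modulus_ge0 (G : set (rect_curve X)) : (0 <= modulus mu p G)%E.
Proof.
by apply: le_ereal_inf_tmp => _ [rho _ <-]; apply: integral_ge0 => y _; exact: poweR_ge0.
Qed.

Lemma modulus_point_small x (S e : R) : dimension_set mu x p ->
  dimension_set mu x <> `]0, 1]%classic -> 0 < S -> 0 < e ->
  exists2 d : R, 0 < d & forall G : set (rect_curve X),
    (forall g, G g -> mdist x (g 0) < d /\ S <= mdist x (g (len g))) ->
    (modulus mu p G <= e%:E)%E.
Proof.
(* The measure bound holds only up to some radius; shrinking [S] to it is harmless, as an end point
   at distance at least [S] is also at least that far from [x]. *)
move=> Qp Qn; wlog Qx : S / exists q C, [/\ p <= q, 1 < q, 0 < C &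
    forall r, 0 < r -> r <= S -> fine (mu (ball x r)) <= C * (r / S) `^ q].
  move=> H S0 e0; have [q [[q0 [C [r0 [C0 r00 HC]]]] pq q1]] := dimension_set_gt1 Qp Qn.
  pose S' := Num.min S r0.
  have S'0 : 0 < S' by rewrite lt_min S0.
  have [||//|d d0 Hd] := H S'.
    exists q, (C * fine (mu (ball x S'))); split => //.
      by rewrite mulr_gt0//; exact: ball_measure_gt0.
    move=> r rp rS; have := HC r S' rp rS; rewrite ge_min lexx orbT => /(_ isT).
    by rewrite ler_pdivrMr ?ball_measure_gt0// mulrAC.
  by [].
  exists d => // G HG; apply: Hd => g /HG[h1 h2]; split => //.
  by apply: le_trans h2; rewrite ge_min lexx.
move=> S0 e0; have [q [C [pq q1 C0 HC]]] := Qx.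
(* The [i]-th term of the annuli bound is at most [n^(-p) (2/S)^p 2^(i p) C 2^(-i q)]; [D] collects
   the factors free of [n] and [i]. *)
pose D := C * (2 / S) `^ p.
have D0 : 0 < D by rewrite mulr_gt0// powR_gt0// divr_gt0.
have eD : 0 < e / D by rewrite divr_gt0.
have [n n0 ne] := sum_geometric_small pq q1 eD.
exists (S / 2 ^+ n) => [|G HG]; first by rewrite divr_gt0// exprn_gt0.
apply: le_trans (modulus_annuli S0 n0 HG) _; rewrite lee_fin.
move: ne; rewrite ltr_pdivlMr// => /ltW; apply: le_trans.
rewrite mulr_sumr mulr_suml; apply: ler_sum => i _.
have i0 : 0 < (2 : R) ^+ i by rewrite exprn_gt0.
have i20 : 0 < (2 : R) ^+ i.+1 by rewrite exprn_gt0.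
have nR : 0 < n%:R :> R by rewrite ltr0n.
have -> : (n%:R * (S / 2 ^+ i.+1))^-1 = n%:R^-1 * ((2 / S) * 2 ^+ i).
  by rewrite invfM invf_div exprS; congr (_ * _); rewrite mulrAC.
apply: (@le_trans _ _ ((n%:R^-1 * (2 / S * 2 ^+ i)) `^ p * (C * (2 ^+ i)^-1 `^ q))).
  rewrite ler_wpM2l ?powR_ge0//.
  have := HC (S / 2 ^+ i); rewrite divr_gt0// => /(_ isT).
  rewrite ler_pdivrMr// ler_peMr ?(ltW S0)// ?exprn_ege1 ?ler1n// => /(_ isT).
  by rewrite mulrAC mulfV ?gt_eqF// mul1r.
have powV (y t : R) : 0 < y -> y^-1 `^ t = y `^ (- t).
  by move=> y0; rewrite -powR_inv1 ?ltW// -powRrM mulN1r.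
have two_pow : (2 : R) ^+ i = 2 `^ i%:R by rewrite powR_mulrn.
have b0 : 0 <= 2 / S by rewrite divr_ge0// ltW.
have -> : (n%:R^-1 * (2 / S * 2 ^+ i)) `^ p = n%:R `^ (- p) *
  ((2 / S) `^ p * 2 `^ (i%:R * p)).
  rewrite powRM ?invr_ge0 ?(ltW nR)//; last by rewrite mulr_ge0 ?(ltW i0).
  by rewrite powRM ?(ltW i0)// powV// two_pow powRrM.
have -> : (2 ^+ i)^-1 `^ q = 2 `^ (i%:R * - q) by rewrite powV// two_pow powRrM.
have -> : (2 `^ (p - q)) ^+ i = 2 `^ (i%:R * p) * 2 `^ (i%:R * - q) :> R.
  rewrite -powR_mulrn ?powR_ge0// -powRrM -powRD; last by apply/implyP => _;
    rewrite pnatr_eq0.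
  by congr powR; ring.
by rewrite /D le_eqVlt; apply/orP; left; apply/eqP; ring.
Qed.

End modulus_of_annuli.

(** The compact set [K] keeps a positive distance [S] from [x], while [F k] lies in [ball x (r k)];
    so the connecting curves run from a tiny ball to distance [S], and their modulus is small. *)
Lemma ball_chain_Mod_chain {R : realType} {X : completeMetricType R}
    (mu : borel_measure X R) (p : R) (Omega : set X) x r (F : nat -> set X) :
  finite_positive_on_balls mu -> 1 <= p -> bounded_domain Omega ->
  @locally_joined R X -> boundary Omega x -> ball_chain Omega x r F ->
  dimension_set mu x p -> dimension_set mu x <> `]0, 1]%classic ->
  is_Mod_chain Omega mu p F.
Proof.
move=> mu_balls p1 dO lj bx bF Qp Qn.
split; first exact: (ball_chain_chain dO lj bx bF).
move=> K cK KO.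
have nKx : ~ K x.
  move=> /KO Ox; case: bx => _; apply; apply: open_nbhs_nbhs; split => //.
  by case: dO.
have clK : closed K by apply: compact_closed => //; exact: metric_hausdorff.
have [S S0 KS] : exists2 S : R, 0 < S & forall y, K y -> S <= mdist x y.
  apply: contrapT => nS; apply: nKx; apply: clK; apply/metric_closureP => e e0.
  apply: contrapT => ny; apply: nS; exists e => // y Ky.
  by rewrite leNgt; apply/negP => xy; apply: ny; exists y.
have small e : 0 < e -> \forall k \near \oo,
    (modulus mu p (connecting_curves (F k) K Omega) <= e%:E)%E.
  move=> e0; have [d d0 Hd] := modulus_point_small mu_balls p1 Qp Qn S0 e0.
  have [n nd] := ball_chain_cvg bF d0.
  exists n => // k /= nk; apply: Hd => g [_ g0 gl]; split; last exact: KS.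
  have Fn := nested_le (ball_chain_nested bF) nk g0.
  by have [+ _] := ball_chain_sub bF Fn; rewrite ballE => /lt_trans; apply.
have m0 k : (0 <= modulus mu p (connecting_curves (F k) K Omega))%E by exact: modulus_ge0.
apply/fine_cvgP; split.
  near=> k; rewrite ge0_fin_numE//.
  apply: (@le_lt_trans _ _ 1%:E); last exact: ltry.
  by near: k; exact: small.
apply/cvgrPdist_le => e e0; near=> k.
rewrite sub0r normrN ger0_norm ?fine_ge0//.
have h : (modulus mu p (connecting_curves (F k) K Omega) <= e%:E)%E by near: k;
  exact: small.
rewrite -lee_fin fineK// ge0_fin_numE//; exact: le_lt_trans h (ltry _).
Unshelve. all: by end_near. Qed.

Theorem theorem10p8 (R : realType) (X : completeMetricType R)
  (mu : borel_measure X R) (p : R) (Omega : set X)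
  (X_two_points : exists x y : X, x <> y)
  (mu_balls : finite_positive_on_balls mu)
  (p_ge1 : 1 <= p)
  (mu_doubling : doubling mu)
  (X_poincare : poincare mu p)
  (Omega_domain : bounded_domain Omega)
  (Omega_proper : Omega `<` setT)
  (Omega_fin_conn : finitely_connected_at_boundary Omega) :
  [/\ forall e, is_prime_end Omega e -> exists x : X, impression e = [set x],
      forall x, boundary Omega x ->
        (exists2 e, is_prime_end Omega e & impression e = [set x]) /\
        accessible Omega x
    & (forall x, boundary Omega x ->
         dimension_set mu x p /\ dimension_set mu x <> `]0, 1]%classic) ->
      prime_end_boundary Omega = Mod_prime_end_boundary Omega mu p].
Proof.
have lj := poincare_locally_joined mu_balls p_ge1 mu_doubling X_poincare.
have proper_space := bounded_closed_compact mu_balls mu_doubling.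
split.
- move=> e pe.
  have [x [r [F [bx bF ->]]]] :=
    prime_end_ball_chain Omega_domain lj proper_space Omega_fin_conn pe.
  by exists x; exact: (ball_chain_end_impression Omega_domain lj bx bF).
- move=> x bx.
  have [r [F bF]] := boundary_ball_chain Omega_domain Omega_fin_conn bx.
  split; last exact: (ball_chain_accessible Omega_domain lj bx bF).
  exists (end_of Omega F); first exact: (ball_chain_prime Omega_domain lj bx bF).
  exact: (ball_chain_end_impression Omega_domain lj bx bF).
- move=> Qdim; apply: (prime_end_boundary_Mod Omega_domain lj proper_space Omega_fin_conn).
  move=> x r F bx bF; have [Qp Qn] := Qdim x bx.
  exact: (ball_chain_Mod_chain mu_balls p_ge1 Omega_domain lj bx bF Qp Qn).
Qed.
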